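(* Let $\mathbb{F}$ be an arbitrary field and let $\mathrm{GL}_\infty(\mathbb{F})$ be the stable general linear group over $\mathbb{F}$, with its determinant homomorphism $\det:\mathrm{GL}_\infty(\mathbb{F})\to\mathbb{F}^*$. Then: (a) An element of $\mathrm{GL}_\infty(\mathbb{F})$ is a product of (finitely many) involutions of $\mathrm{GL}_\infty(\mathbb{F})$ if and only if its determinant equals $\pm 1$. (b) An element of $\mathrm{GL}_\infty(\mathbb{F})$ is the product of two involutions of $\mathrm{GL}_\infty(\mathbb{F})$ if and only if it is conjugated to its inverse in $\mathrm{GL}_\infty(\mathbb{F})$. (c) Every element of $\mathrm{GL}_\infty(\mathbb{F})$ with determinant $\pm 1$ is the product of three involutions of $\mathrm{GL}_\infty(\mathbb{F})$.
   Context: For square matrices $A,B$, $A\oplus B$ denotes the block-diagonal matrix with diagonal blocks $A,B$, and $I_n$ is the $n\times n$ identity matrix. For $A\in\mathrm{GL}_n(\mathbb{F})$ and $B\in\mathrm{GL}_p(\mathbb{F})$, $A$ and $B$ are stably equal if $A\oplus I_p=B\oplus I_n$. This is an equivalence relation on $\bigcup_{n\in\mathbb{N}}\mathrm{GL}_n(\mathbb{F})$, and $\mathrm{GL}_\infty(\mathbb{F})$ is the quotient set, made into a group by letting the product of the classes of $A\in\mathrm{GL}_n(\mathbb{F})$ and $B\in\mathrm{GL}_p(\mathbb{F})$ be the class of $(A\oplus I_p)(B\oplus I_n)$. All matrices in an equivalence class have the same determinant, which is called the determinant of the class; this yields a group homomorphism $\mathrm{GL}_\infty(\mathbb{F})\to\mathbb{F}^*$.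 An element $x$ of a group $G$ is called an involution if $x^2=1_G$ (so the identity is an involution). *)

(* Defs.v *)
From HB Require Import structures.
From mathcomp Require Import all_boot all_order all_algebra.

Set Implicit Arguments.
Unset Strict Implicit.
Unset Printing Implicit Defensive.

Import GRing.Theory.
Local Open Scope ring_scope.
Local Open Scope quotient_scope.

Section StableEquality.
Variable F : fieldType.

Definition dsum m n (A : 'M[F]_m) (B : 'M[F]_n) : 'M[F]_(m + n) :=
  block_mx A 0 0 B.

(* The cast identifies the sizes n + p and p + n, which are not convertible. *)
Definition stably_equal n p (A : 'M[F]_n) (B : 'M[F]_p) : bool :=
  castmx (addnC n p, addnC n p) (dsum A (1%:M : 'M_p))
    == dsum B (1%:M : 'M_n).

Definition stable_mul n p (A : 'M[F]_n) (B : 'M[F]_p) : 'M[F]_(n + p) :=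
  dsum A (1%:M : 'M_p)
    *m castmx (addnC p n, addnC p n) (dsum B (1%:M : 'M_n)).

(* Auxiliary: the entries of A (+) I_oo, indexed by nat * nat. *)
Definition ext n (A : 'M[F]_n) (i j : nat) : F :=
  if insub i is Some i' then
    if insub j is Some j' then A i' j' else (i == j)%:R
  else (i == j)%:R.

Lemma ext_in n (A : 'M[F]_n) (i j : 'I_n) : ext A i j = A i j.
Proof. by rewrite /ext !valK. Qed.

Lemma ext_outl n (A : 'M[F]_n) i j : (n <= i)%N -> ext A i j = (i == j)%:R.
Proof. by move=> ni; rewrite /ext insubN // -leqNgt. Qed.

Lemma ext_outr n (A : 'M[F]_n) i j : (n <= j)%N -> ext A i j = (i == j)%:R.
Proof.
by move=> nj; rewrite /ext; case: insub => // i'; rewrite insubN // -leqNgt.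
Qed.

Lemma ext_inj n (A B : 'M[F]_n) : ext A =2 ext B -> A = B.
Proof. by move=> e; apply/matrixP=> i j; rewrite -!ext_in e. Qed.

Lemma ext_cast n m (e : n = m) (A : 'M[F]_n) : ext (castmx (e, e) A) =2 ext A.
Proof. by case: m / e => i j; rewrite castmx_id. Qed.

Lemma ext_id n : ext (1%:M : 'M[F]_n) =2 fun i j => (i == j)%:R.
Proof.
move=> i j; case: (ltnP i n) => [lin|/ext_outl //].
case: (ltnP j n) => [ljn|/ext_outr //].
by rewrite (ext_in _ (Ordinal lin) (Ordinal ljn)) mxE.
Qed.

Lemma ext_dsum n p (A : 'M[F]_n) : ext (dsum A (1%:M : 'M_p)) =2 ext A.
Proof.
move=> i j; case: (ltnP i (n + p)) => [li|hi]; last first.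
  by rewrite !ext_outl // (leq_trans _ hi) // leq_addr.
case: (ltnP j (n + p)) => [lj|hj]; last first.
  by rewrite !ext_outr // (leq_trans _ hj) // leq_addr.
rewrite (ext_in _ (Ordinal li) (Ordinal lj)) /dsum.
rewrite -[RHS]/(ext A (val (Ordinal li)) (val (Ordinal lj))).
move: (Ordinal li) (Ordinal lj) => {li lj i j} x y.
case: (split_ordP x) => i' -> /=; case: (split_ordP y) => j' -> /=.
- by rewrite block_mxEul ext_in.
- rewrite block_mxEur mxE ext_outr ?leq_addr //.
  by rewrite ltn_eqF // (leq_trans (ltn_ord i')) ?leq_addr.
- rewrite block_mxEdl mxE ext_outl ?leq_addr //.
  by rewrite gtn_eqF // (leq_trans (ltn_ord j')) ?leq_addr.
- by rewrite block_mxEdr mxE ext_outl ?leq_addr // eqn_add2l.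
Qed.

Lemma stably_equalP n p (A : 'M[F]_n) (B : 'M[F]_p) :
  reflect (ext A =2 ext B) (stably_equal A B).
Proof.
apply: (iffP eqP) => [e i j|e].
  by rewrite -(ext_dsum p A) -(ext_dsum n B) -e ext_cast.
by apply: ext_inj => i j; rewrite ext_cast !ext_dsum.
Qed.

Lemma ext_mulmx N n (A B : 'M[F]_n) i j : (n <= N)%N -> (j < N)%N ->
  ext (A *m B) i j = \sum_(k < N) ext A i k * ext B k j.
Proof.
move=> nN jN; case: (ltnP i n) => [lin|hin]; last first.
  rewrite ext_outl //; case: (ltnP i N) => [liN|hiN].
    rewrite (bigD1 (Ordinal liN)) //= big1 ?addr0 => [|k ne].
      by rewrite !ext_outl // eqxx mul1r.
    rewrite ext_outl // (_ : (i == k) = false) ?mul0r //.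
    by apply: contraNF ne => /eqP e; apply/eqP/val_inj; rewrite /= -e.
  rewrite gtn_eqF ?(leq_trans jN) // big1 // => k _.
  by rewrite ext_outl // gtn_eqF ?mul0r // (leq_trans (ltn_ord k)).
case: (ltnP j n) => [ljn|hjn]; last first.
  rewrite ext_outr // (bigD1 (Ordinal jN)) //= big1 ?addr0 => [|k ne].
    by rewrite !ext_outr // eqxx mulr1.
  by rewrite [ext B _ _]ext_outr // -[j]/(val (Ordinal jN)) val_eqE
     (negPf ne) mulr0.
rewrite (ext_in _ (Ordinal lin) (Ordinal ljn)) mxE.
rewrite [RHS](bigID (fun k : 'I_N => (k < n)%N)) /= [X in _ + X]big1 ?addr0.
  rewrite -(big_ord_widen N (fun k => ext A i k * ext B k j)) //.
  apply: eq_bigr => k _.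
  by rewrite (ext_in _ (Ordinal lin)) (ext_in _ _ (Ordinal ljn)).
move=> k; rewrite -leqNgt => nk.
by rewrite ext_outr // ltn_eqF ?mul0r // (leq_trans lin).
Qed.

Lemma ext_stable_mul N n p (A : 'M[F]_n) (B : 'M[F]_p) i j :
  (n + p <= N)%N -> (j < N)%N ->
  ext (stable_mul A B) i j = \sum_(k < N) ext A i k * ext B k j.
Proof.
move=> leN jN; rewrite /stable_mul (ext_mulmx (N := N)) //.
by apply: eq_bigr => k _; rewrite ext_cast !ext_dsum.
Qed.

Lemma det_cast n m (e : n = m) (A : 'M[F]_n) : \det (castmx (e, e) A) = \det A.
Proof. by case: m / e; rewrite castmx_id. Qed.

Lemma det_dsum n p (A : 'M[F]_n) : \det (dsum A (1%:M : 'M_p)) = \det A.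
Proof. by rewrite /dsum det_ublock det1 mulr1. Qed.

Lemma det_stable_mul n p (A : 'M[F]_n) (B : 'M[F]_p) :
  \det (stable_mul A B) = \det A * \det B.
Proof. by rewrite /stable_mul det_mulmx det_cast !det_dsum. Qed.

Lemma det_stably_equal n p (A : 'M[F]_n) (B : 'M[F]_p) :
  stably_equal A B -> \det A = \det B.
Proof. by move/eqP/(congr1 determinant); rewrite det_cast !det_dsum. Qed.

Lemma stable_mul_unit n p (A : 'M[F]_n) (B : 'M[F]_p) :
  A \in unitmx -> B \in unitmx -> stable_mul A B \in unitmx.
Proof. by rewrite !unitmxE det_stable_mul unitrM => -> ->. Qed.

Lemma stably_equal_mul n p n' p' (A : 'M[F]_n) (B : 'M[F]_p)
    (A' : 'M[F]_n') (B' : 'M[F]_p') :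
  stably_equal A A' -> stably_equal B B' ->
  stably_equal (stable_mul A B) (stable_mul A' B').
Proof.
move=> /stably_equalP eA /stably_equalP eB; apply/stably_equalP => i j.
set N := (n + p + (n' + p') + j.+1)%N.
have jN : (j < N)%N by rewrite /N addnS ltnS leq_addl.
have h1 : (n + p <= N)%N by rewrite /N -addnA leq_addr.
have h2 : (n' + p' <= N)%N by rewrite /N addnAC leq_addl.
rewrite (ext_stable_mul _ _ _ h1 jN) (ext_stable_mul _ _ _ h2 jN).
by apply: eq_bigr => k _; rewrite eA eB.
Qed.

Lemma stably_equal_mulA n p q (A : 'M[F]_n) (B : 'M[F]_p) (C : 'M[F]_q) :
  stably_equal (stable_mul A (stable_mul B C)) (stable_mul (stable_mul A B) C).
Proof.
apply/stably_equalP => i j; set N := (n + p + q + j.+1)%N.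
have jN : (j < N)%N by rewrite /N addnS ltnS leq_addl.
have h1 : (n + (p + q) <= N)%N by rewrite /N addnA leq_addr.
have h2 : (n + p + q <= N)%N by rewrite leq_addr.
have h3 : (p + q <= N)%N by rewrite (leq_trans _ h1) ?leq_addl.
have h4 : (n + p <= N)%N by rewrite (leq_trans _ h2) ?leq_addr.
rewrite (ext_stable_mul _ _ _ h1 jN) (ext_stable_mul _ _ _ h2 jN).
under eq_bigr => k _ do rewrite (ext_stable_mul _ _ _ h3 jN) mulr_sumr.
rewrite exchange_big; apply: eq_bigr => l _ /=.
rewrite (ext_stable_mul _ _ _ h4 (ltn_ord l)) mulr_suml.
by apply: eq_bigr => k _; rewrite mulrA.
Qed.

Lemma stably_equal_mul1l n p (A : 'M[F]_n) :
  stably_equal (stable_mul (1%:M : 'M_p) A) A.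
Proof.
apply/stably_equalP => i j; rewrite /stable_mul /dsum.
by rewrite -scalar_mx_block mul1mx ext_cast ext_dsum.
Qed.

Lemma stably_equal_mul1r n p (A : 'M[F]_n) :
  stably_equal (stable_mul A (1%:M : 'M_p)) A.
Proof.
apply/stably_equalP => i j; rewrite /stable_mul {2}/dsum.
rewrite -scalar_mx_block (_ : castmx _ _ = 1%:M) ?mulmx1 ?ext_dsum //.
by apply: ext_inj => k l; rewrite ext_cast !ext_id.
Qed.

Lemma stable_mul_same n (A B : 'M[F]_n) :
  stably_equal (stable_mul A B) (A *m B).
Proof.
apply/stably_equalP => i j; set N := (n + n + j.+1)%N.
have jN : (j < N)%N by rewrite /N addnS ltnS leq_addl.
have h1 : (n + n <= N)%N by rewrite leq_addr.
have h2 : (n <= N)%N by rewrite (leq_trans _ h1) ?leq_addr.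
by rewrite (ext_stable_mul _ _ _ h1 jN) (ext_mulmx _ _ _ h2 jN).
Qed.

Lemma stably_equal_id n p : stably_equal (1%:M : 'M[F]_n) (1%:M : 'M[F]_p).
Proof. by apply/stably_equalP => i j; rewrite !ext_id. Qed.

End StableEquality.

Section StableLinearGroup.
Variable F : fieldType.

Definition GLn n := {A : 'M[F]_n | A \in unitmx}.

(* The size 0 is allowed; the class of the empty matrix is that of every I_n. *)
Definition GLunion := {n : nat & GLn n}.

Implicit Types a b : GLunion.

Definition mx_of a : 'M[F]_(tag a) := val (tagged a).

Definition mkGL n (A : 'M[F]_n) (uA : A \in unitmx) : GLunion :=
  Tagged GLn (exist _ A uA).

Definition gl_eq a b : bool := stably_equal (mx_of a) (mx_of b).

Lemma gl_eqP a b : reflect (ext (mx_of a) =2 ext (mx_of b)) (gl_eq a b).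
Proof. exact: stably_equalP. Qed.

Lemma gl_eq_refl : reflexive gl_eq.
Proof. by move=> a; apply/gl_eqP. Qed.

Lemma gl_eq_sym : symmetric gl_eq.
Proof. by move=> a b; apply/gl_eqP/gl_eqP => e i j; rewrite e. Qed.

Lemma gl_eq_trans : transitive gl_eq.
Proof.
by move=> b a c /gl_eqP eab /gl_eqP ebc; apply/gl_eqP => i j; rewrite eab.
Qed.

Canonical gl_eq_equiv := EquivRel gl_eq gl_eq_refl gl_eq_sym gl_eq_trans.

Definition GLinf := {eq_quot gl_eq}.

HB.instance Definition _ := Choice.on GLinf.
HB.instance Definition _ := EqQuotient.on GLinf.

Definition GLclass n (A : 'M[F]_n) (uA : A \in unitmx) : GLinf :=
  \pi_GLinf (mkGL uA).

Definition gl_mul a b : GLunion :=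
  mkGL (stable_mul_unit (valP (tagged a)) (valP (tagged b))).

Definition gl_one : GLunion := mkGL (unitmx1 F 0).

Lemma gl_inv_proof a : invmx (mx_of a) \in unitmx.
Proof. by rewrite unitmx_inv (valP (tagged a)). Qed.

Definition gl_inv a : GLunion := mkGL (gl_inv_proof a).

Definition GLinf_mul := lift_op2 GLinf gl_mul.
Definition GLinf_one : GLinf := \pi_GLinf gl_one.
Definition GLinf_inv := lift_op1 GLinf gl_inv.

Lemma gl_eq_repr a : gl_eq a (repr (\pi_GLinf a)).
Proof. by apply/eqmodP; rewrite reprK. Qed.

Lemma pi_GLinf_mul : {morph \pi_GLinf : a b / gl_mul a b >-> GLinf_mul a b}.
Proof.
move=> a b; unlock GLinf_mul; apply/eqmodP.
exact: stably_equal_mul (gl_eq_repr a) (gl_eq_repr b).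
Qed.

Lemma GLinf_mulA : associative GLinf_mul.
Proof.
elim/quotW=> a; elim/quotW=> b; elim/quotW=> c; rewrite -!pi_GLinf_mul.
exact/eqmodP/stably_equal_mulA.
Qed.

Lemma GLinf_mul1g : left_id GLinf_one GLinf_mul.
Proof.
by elim/quotW=> a; rewrite -pi_GLinf_mul; apply/eqmodP/stably_equal_mul1l.
Qed.

Lemma GLinf_mulg1 : right_id GLinf_one GLinf_mul.
Proof.
by elim/quotW=> a; rewrite -pi_GLinf_mul; apply/eqmodP/stably_equal_mul1r.
Qed.

Lemma gl_mulVg a : gl_eq (gl_mul (gl_inv a) a) gl_one.
Proof.
apply: (@gl_eq_trans (mkGL (unitmx1 F (tag a)))); last exact: stably_equal_id.
by have := stable_mul_same (invmx (mx_of a)) (mx_of a);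
  rewrite mulVmx ?(valP (tagged a)).
Qed.

Lemma gl_mulgV a : gl_eq (gl_mul a (gl_inv a)) gl_one.
Proof.
apply: (@gl_eq_trans (mkGL (unitmx1 F (tag a)))); last exact: stably_equal_id.
by have := stable_mul_same (mx_of a) (invmx (mx_of a));
  rewrite mulmxV ?(valP (tagged a)).
Qed.

Lemma GLinf_mulVg : left_inverse GLinf_one GLinf_inv GLinf_mul.
Proof.
move=> x; unlock GLinf_inv; rewrite -[X in GLinf_mul _ X]reprK -pi_GLinf_mul.
exact/eqmodP/gl_mulVg.
Qed.

Lemma GLinf_mulgV : right_inverse GLinf_one GLinf_inv GLinf_mul.
Proof.
move=> x; unlock GLinf_inv; rewrite -[X in GLinf_mul X _]reprK -pi_GLinf_mul.
exact/eqmodP/gl_mulgV.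
Qed.

HB.instance Definition _ := isGroup.Build GLinf GLinf_mulA GLinf_mul1g
  GLinf_mulg1 GLinf_mulVg GLinf_mulgV.

Lemma GLclassM n p (A : 'M[F]_n) (B : 'M[F]_p)
    (uA : A \in unitmx) (uB : B \in unitmx) :
  (GLclass uA * GLclass uB)%g = GLclass (stable_mul_unit uA uB).
Proof.
rewrite [RHS]/GLclass (bool_irrelevance (stable_mul_unit uA uB)
  (stable_mul_unit (valP (tagged (mkGL uA))) (valP (tagged (mkGL uB))))).
exact/esym/(pi_GLinf_mul (mkGL uA) (mkGL uB)).
Qed.

Lemma GLclass_eq n p (A : 'M[F]_n) (B : 'M[F]_p)
    (uA : A \in unitmx) (uB : B \in unitmx) :
  reflect (GLclass uA = GLclass uB) (stably_equal A B).
Proof. by apply: (iffP idP) => [e|/eqmodP //]; apply/eqmodP. Qed.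

Lemma GLclass_ex (x : GLinf) :
  exists n (A : 'M[F]_n) (uA : A \in unitmx), x = GLclass uA.
Proof.
elim/quotW: x => -[n [A uA]]; exists n, A, uA; exact: erefl.
Qed.

Definition GLdet (x : GLinf) : F := \det (mx_of (repr x)).

Lemma GLdet_class n (A : 'M[F]_n) (uA : A \in unitmx) :
  GLdet (GLclass uA) = \det A.
Proof. exact/esym/det_stably_equal/(gl_eq_repr (mkGL uA)). Qed.

(* F^* is not a separate type here: GLdet takes values in F, and the next three
   lemmas say that it is a group homomorphism into the nonzero elements. *)
Lemma GLdet_neq0 (x : GLinf) : GLdet x != 0.
Proof. by rewrite -unitfE -unitmxE (valP (tagged (repr x))). Qed.

Lemma GLdet1 : GLdet 1%g = 1.
Proof. by rewrite [LHS]GLdet_class det1. Qed.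

Lemma GLdetM (x y : GLinf) : GLdet (x * y)%g = GLdet x * GLdet y.
Proof.
have [n [A [uA ->]]] := GLclass_ex x; have [p [B [uB ->]]] := GLclass_ex y.
by rewrite GLclassM !GLdet_class det_stable_mul.
Qed.

End StableLinearGroup.

Definition involution (G : groupType) (x : G) : Prop := (x ^+ 2 = 1)%g.

(* Main.v *)
Require Import Defs.
From mathcomp Require Import all_boot all_order all_algebra.

Set Implicit Arguments.
Unset Strict Implicit.
Unset Printing Implicit Defensive.

Import GRing.Theory.
Local Open Scope ring_scope.

(** An involution has determinant 1 or -1, and finitely many elements of the
    stable group have representatives of a common size, so the result rests on
    two facts about matrices.

    A matrix similar to its inverse is a product of two involutions
    ([msim_inverse_two_invols]). Suppose first that M is cyclic, that is,
    multiplication by X on F[X]/(p), and that p also annihilates M^-1. Then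
    f(X) |-> f(1/X) is a well-defined linear involution s of F[X]/(p), and
    s M s = M^-1, so M = s (s M) is a product of two involutions
    ([cyclic_reversal]). For a general M, let p be its minimal polynomial and
    split off a cyclic summand C with the same minimal polynomial
    ([cyclic_vector_exists], [cyclic_summand]). As p annihilates M^-1 too, C is
    reversed as above. To go on with the complement without a cancellation
    theorem for similarity, the induction does not assume that M is similar to
    M^-1, but only that f(M) and f(M^-1) have the same rank for every f. This
    holds for C, ranks add up over direct sums, and so it holds for the
    complement ([selfdual_rank_two_invols]). The rank condition is also easy to
    check when 1 and -1 are the only eigenvalues of M
    ([spectrum_pm1_two_invols]).

    If det A = 1 or -1, then A (+) I_p is a product of three involutions for
    some p ([stable_three_invols]). By Fitting's lemma A is similar to
    U (+) A0 with U unipotent and A0 - I invertible, and U is a product of two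
    involutions already. Since A0 - I is invertible, for every E the matrix
    A0 (+) I is similar to

      | A0 E |   | 0 I | | 0  I |
      | 0  I | = | I 0 | | A0 E |

    and, when -A0 = X Y and E = X + Y, the last factor is similar to the
    block triangular matrix with diagonal blocks Y, X and corner I. It remains
    to choose X and Y so that this matrix is a product of two involutions.
    If A0 is not scalar, one can take X and Y triangularizable with eigenvalues
    1 and -1 ([nonscalar_factor]). If A0 = d I with d^2 = 1, it is itself an
    involution. If A0 = d I with d^2 <> 1, the equation Y = -d X^-1 makes such
    eigenvalues impossible; instead X is a weighted cyclic shift, chosen so that
    the triangular matrix is similar to X (+) Y. The latter is similar to its
    inverse because, up to similarity, multiplying a cyclic shift of size n by a
    only multiplies its weight by a^n, and (-d)^n = 1 or -1
    ([scalar_factor]).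

    Matrices act on row vectors from the right. *)

(** * Evaluation of polynomials at matrices of any size *)
Section Eval.
Variable F : fieldType.

(** [horner_mx] asks for a size of the form n.+1, but the complements split off
    below may have size 0. *)
Definition mxeval n (A : 'M[F]_n) (f : {poly F}) : 'M[F]_n :=
  match n return 'M[F]_n -> 'M[F]_n with
  | 0 => fun _ => 0
  | n'.+1 => fun A => horner_mx A f
  end A.

Lemma mxeval0 n (A : 'M[F]_n) : mxeval A 0 = 0.
Proof. by case: n A => [|n] A /=; rewrite ?rmorph0. Qed.

Lemma mxevalC n (A : 'M[F]_n) c : mxeval A c%:P = c%:M.
Proof. by case: n A => [|n] A /=; rewrite ?horner_mx_C // [RHS]flatmx0. Qed.

Lemma mxeval1 n (A : 'M[F]_n) : mxeval A 1 = 1%:M.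
Proof. exact: mxevalC. Qed.

Lemma mxevalX n (A : 'M[F]_n) : mxeval A 'X = A.
Proof. by case: n A => [|n] A /=; rewrite ?horner_mx_X // [RHS]flatmx0. Qed.

Lemma mxevalD n (A : 'M[F]_n) f g : mxeval A (f + g) = mxeval A f + mxeval A g.
Proof. by case: n A => [|n] A /=; rewrite ?rmorphD ?addr0. Qed.

Lemma mxevalB n (A : 'M[F]_n) f g : mxeval A (f - g) = mxeval A f - mxeval A g.
Proof. by case: n A => [|n] A /=; rewrite ?rmorphB ?subr0. Qed.

Lemma mxevalM n (A : 'M[F]_n) f g : mxeval A (f * g) = mxeval A f *m mxeval A g.
Proof. by case: n A => [|n] A /=; rewrite ?rmorphM ?mulmx0. Qed.

Lemma mxevalMC n (A : 'M[F]_n) f g :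
  mxeval A f *m mxeval A g = mxeval A g *m mxeval A f.
Proof. by rewrite -!mxevalM mulrC. Qed.

(** Applied to a matrix K whose row space is stable, this transports polynomial
    identities between a matrix and its restriction or quotient. *)
Lemma mxeval_intertwine m n (A : 'M[F]_m) (B : 'M[F]_n) (K : 'M[F]_(m, n)) f :
  A *m K = K *m B -> mxeval A f *m K = K *m mxeval B f.
Proof.
move=> AK; elim/poly_ind: f => [|f c IH].
  by rewrite !mxeval0 mul0mx mulmx0.
rewrite !mxevalD !mxevalM !mxevalX !mxevalC mulmxDl mulmxDr scalar_mxC.
by rewrite -mulmxA AK !mulmxA IH.
Qed.

End Eval.

(** * Similarity and block-diagonal sums *)
Section Similarity.
Variable F : fieldType.

(** The two sizes are equal, but only provably so: keeping them distinct, with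
    rectangular P and Q, avoids casts between sums of sizes. *)
Definition msim m n (A : 'M[F]_m) (B : 'M[F]_n) : Prop :=
  exists P : 'M[F]_(m, n), exists Q : 'M[F]_(n, m),
    [/\ P *m Q = 1%:M, Q *m P = 1%:M & A = P *m B *m Q].

Lemma msim_refl n (A : 'M[F]_n) : msim A A.
Proof. by exists 1%:M, 1%:M; rewrite !mulmx1 mul1mx. Qed.

Lemma msim_sym m n (A : 'M[F]_m) (B : 'M[F]_n) : msim A B -> msim B A.
Proof.
case=> P [Q [PQ QP ->]]; exists Q, P; split=> //.
by rewrite !mulmxA QP mul1mx -mulmxA QP mulmx1.
Qed.

Lemma msim_trans n m p (B : 'M[F]_n) (A : 'M[F]_m) (C : 'M[F]_p) :
  msim A B -> msim B C -> msim A C.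
Proof.
case=> P [Q [PQ QP ->]] [P' [Q' [PQ' QP' ->]]].
exists (P *m P'), (Q' *m Q); split; last by rewrite !mulmxA.
  by rewrite mulmxA -(mulmxA P) PQ' mulmx1.
by rewrite mulmxA -(mulmxA Q') QP mulmx1.
Qed.

Lemma msim_conj n (P A B : 'M[F]_n) :
  P \in unitmx -> P *m A = B *m P -> msim A B.
Proof.
move=> uP e; exists (invmx P), P; rewrite mulVmx // mulmxV //; split=> //.
by rewrite -mulmxA -e mulmxA mulVmx // mul1mx.
Qed.

Lemma msim_castmx m n (e : m = n) (A : 'M[F]_m) : msim (castmx (e, e) A) A.
Proof. by case: n / e; rewrite castmx_id; apply: msim_refl. Qed.

Lemma mul_dsum m n m' n' m'' n'' (A : 'M[F]_(m, m')) (B : 'M[F]_(n, n'))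
    (A' : 'M[F]_(m', m'')) (B' : 'M[F]_(n', n'')) :
  block_mx A 0 0 B *m block_mx A' 0 0 B' = block_mx (A *m A') 0 0 (B *m B').
Proof. by rewrite mulmx_block !mulmx0 !mul0mx !addr0 !add0r. Qed.

Lemma msim_dsum m n m' n' (A : 'M[F]_m) (B : 'M[F]_n) (A' : 'M[F]_m')
    (B' : 'M[F]_n') :
  msim A A' -> msim B B' -> msim (dsum A B) (dsum A' B').
Proof.
case=> P [Q [PQ QP ->]] [P' [Q' [PQ' QP' ->]]].
exists (block_mx P 0 0 P'), (block_mx Q 0 0 Q').
by rewrite /dsum !mul_dsum PQ PQ' QP QP' -!scalar_mx_block.
Qed.

Lemma msim_dsumA m n p (A : 'M[F]_m) (B : 'M[F]_n) (C : 'M[F]_p) :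
  msim (dsum (dsum A B) C) (dsum A (dsum B C)).
Proof.
have /= := block_mxAx A 0 0 0 B 0 0 0 C.
rewrite !row_mx0 !col_mx0 -[block_mx B 0 0 C]/(dsum B C) /dsum => ->.
exact/msim_sym/msim_castmx.
Qed.

Lemma mxeval_sim m n (A : 'M[F]_m) (B : 'M[F]_n) P Q f :
  P *m Q = 1%:M -> Q *m P = 1%:M -> A = P *m B *m Q ->
  mxeval A f = P *m mxeval B f *m Q.
Proof.
move=> PQ QP eA; have AP : A *m P = P *m B by rewrite eA -mulmxA QP mulmx1.
by rewrite -(mxeval_intertwine f AP) -mulmxA PQ mulmx1.
Qed.

Lemma mxrank_sim m n (A : 'M[F]_m) (B : 'M[F]_n) P Q :
  P *m Q = 1%:M -> Q *m P = 1%:M -> A = P *m B *m Q -> \rank A = \rank B.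
Proof.
move=> PQ QP e.
have e' : B = Q *m A *m P by rewrite e !mulmxA QP mul1mx -mulmxA QP mulmx1.
apply/eqP; rewrite eqn_leq; apply/andP; split.
  by rewrite {1}e (leq_trans (mxrankM_maxl _ _)) ?mxrankM_maxr.
by rewrite {1}e' (leq_trans (mxrankM_maxl _ _)) ?mxrankM_maxr.
Qed.

Lemma mxeval_dsum m n (A : 'M[F]_m) (B : 'M[F]_n) f :
  mxeval (dsum A B) f = dsum (mxeval A f) (mxeval B f).
Proof.
elim/poly_ind: f => [|f c IH]; first by rewrite !mxeval0 /dsum block_mx0.
rewrite !mxevalD !mxevalM !mxevalX !mxevalC IH /dsum mul_dsum scalar_mx_block.
by rewrite add_block_mx !addr0.
Qed.

End Similarity.

(** * Splitting along a complemented subspace *)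
Section Splitting.
Variable F : fieldType.

Lemma idempotent_factor n (e : 'M[F]_n) : e *m e = e ->
  exists r, exists K : 'M[F]_(r, n), exists Y : 'M[F]_(n, r),
    K *m Y = 1%:M /\ Y *m K = e.
Proof.
move=> ee; pose K := row_base e.
have YK : e *m pinvmx K *m K = e by rewrite mulmxKpV // eq_row_base.
have /submxP[D KD] : (K <= e)%MS by rewrite eq_row_base.
exists (\rank e), K, (e *m pinvmx K); split=> //.
apply: (row_free_inj (row_base_free e)).
by rewrite /= -/K -mulmxA YK mul1mx KD -mulmxA ee.
Qed.

(** The idempotent 1 - Y K projects onto the complement of the row space of K
    along which Y vanishes; Z and W come from a basis of its image. *)
Lemma complement_mx d n (K : 'M[F]_(d, n)) (Y : 'M[F]_(n, d)) :
  K *m Y = 1%:M ->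
  exists r, exists Z : 'M[F]_(r, n), exists W : 'M[F]_(n, r),
    [/\ Z *m W = 1%:M, K *m W = 0, Z *m Y = 0 & Y *m K + W *m Z = 1%:M].
Proof.
move=> KY; pose e := 1%:M - Y *m K.
have Ke : K *m e = 0 by rewrite mulmxBr mulmx1 mulmxA KY mul1mx subrr.
have eY : e *m Y = 0 by rewrite mulmxBl mul1mx -mulmxA KY mulmx1 subrr.
have ee : e *m e = e by rewrite {1}/e mulmxBl mul1mx -mulmxA Ke mulmx0 subr0.
have [r [Z [W [ZW WZ]]]] := idempotent_factor ee.
exists r, Z, W; split=> //; last by rewrite WZ addrC subrK.
  by rewrite -[W]mulmx1 -ZW (mulmxA W) WZ mulmxA Ke mul0mx.
by rewrite -[Z]mul1mx -ZW -(mulmxA Z) WZ -mulmxA eY mulmx0.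
Qed.

(** If the projection Y K commutes with M, both summands are stable under M. The
    same change of basis serves all such M, so that it block-diagonalizes a
    matrix and its inverse at once. *)
Lemma split_commuting d r n (K : 'M[F]_(d, n)) Y (Z : 'M[F]_(r, n)) W :
  K *m Y = 1%:M -> Z *m W = 1%:M -> K *m W = 0 -> Z *m Y = 0 ->
  Y *m K + W *m Z = 1%:M ->
  [/\ row_mx Y W *m col_mx K Z = 1%:M, col_mx K Z *m row_mx Y W = 1%:M
    & forall M : 'M[F]_n, Y *m K *m M = M *m (Y *m K) ->
      M = row_mx Y W *m dsum (K *m M *m Y) (Z *m M *m W) *m col_mx K Z].
Proof.
move=> KY ZW KW ZY e1; split.
- by rewrite mul_row_col.
- by rewrite mul_col_row KY KW ZY ZW -scalar_mx_block.
move=> M eM; have {}e1 : W *m Z = 1%:M - Y *m K by rewrite -e1 addrC addKr.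
rewrite mul_row_block !mulmx0 add0r addr0 mul_row_col.
have -> : Y *m (K *m M *m Y) *m K = Y *m K *m M.
  rewrite !mulmxA -(mulmxA _ Y K) -!mulmxA -eM !mulmxA.
  by rewrite -(mulmxA Y K Y) KY mulmx1.
have -> : W *m (Z *m M *m W) *m Z = W *m Z *m M.
  rewrite !mulmxA -(mulmxA _ W Z) -!mulmxA.
  have -> : M *m (W *m Z) = W *m Z *m M.
    by rewrite e1 mulmxBl mulmxBr mul1mx mulmx1 eM.
  by rewrite !mulmxA -(mulmxA W Z W) ZW mulmx1.
by rewrite -mulmxDl e1 addrC subrK mul1mx.
Qed.

End Splitting.

(** * A vector whose annihilator is the minimal polynomial *)
Section CyclicVector.
Variable F : fieldType.

Lemma annihilator_exists n (M : 'M[F]_n) :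
  exists2 p, p != 0 & mxeval M p = 0.
Proof.
case: n M => [|n] M; first by exists 1; rewrite ?oner_eq0 // [LHS]flatmx0.
exists (mxminpoly M); last exact: mx_root_minpoly.
by apply: monic_neq0; apply: mxminpoly_monic.
Qed.

Variables (n : nat) (M : 'M[F]_n).

(** f generates the ideal of the polynomials g such that g(M) kills v. *)
Definition exact_order (v : 'rV[F]_n) (f : {poly F}) : Prop :=
  forall g, v *m mxeval M g = 0 <-> f %| g.

Definition krylov (v : 'rV[F]_n) k : 'M[F]_(k, n) :=
  \matrix_(i < k) (v *m mxeval M 'X^i).

Lemma mul_krylov v k (a : 'rV[F]_k) :
  a *m krylov v k = v *m mxeval M (rVpoly a).
Proof.
have evsum (I : finType) (E : I -> {poly F}) :
    mxeval M (\sum_i E i) = \sum_i mxeval M (E i).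
  apply: (big_morph (mxeval M)); [exact: mxevalD | exact: mxeval0].
rewrite /rVpoly poly_def evsum mulmx_sum_row mulmx_sumr.
apply: eq_bigr => i _; rewrite rowK valK -mul_polyC mxevalM mxevalC.
by rewrite mul_scalar_mx -scalemxAr.
Qed.

(** The first linear relation among v, v M, v M^2, ... has minimal degree among
    all nonzero polynomials killing v, so it divides every other one. *)
Lemma exact_order_exists v : exists2 f, f != 0 & exact_order v f.
Proof.
have ex : exists k, ~~ row_free (krylov v k.+1).
  by exists n; rewrite /row_free neq_ltn ltnS rank_leq_col.
case: (ex_minnP ex) => k; rewrite -kermx_eq0 => /rowV0Pn[a].
move=> /sub_kermxP; rewrite mul_krylov => fv a0 kmin.
have f0 : rVpoly a != 0.
  by apply: contraNneq a0 => f0; rewrite -[a]rVpolyK f0 linear0.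
have freek : row_free (krylov v k).
  case: k {a fv a0 f0} kmin => [|k] kmin.
    by rewrite /row_free flatmx0 mxrank0.
  by apply: contraT => /kmin; rewrite ltnn.
exists (rVpoly a) => // g; split=> [gv|/dvdpP[q ->]]; last first.
  by rewrite mulrC mxevalM mulmxA fv mul0mx.
have rv : v *m mxeval M (g %% rVpoly a) = 0.
  move: gv; rewrite {1}(divp_eq g (rVpoly a)) mxevalD mulrC mxevalM mulmxDr.
  by rewrite mulmxA fv mul0mx add0r.
have sr : (size (g %% rVpoly a)%R <= k)%N.
  by rewrite -ltnS (leq_trans (ltn_modpN0 _ f0)) // size_poly.
apply/eqP; rewrite -(poly_rV_K sr); have := rv.
rewrite -{1}(poly_rV_K sr) -mul_krylov -(mul0mx _ (krylov v k)).
by move/(row_free_inj freek) ->; rewrite linear0.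
Qed.

Lemma exact_order_shift v f g : f != 0 ->
  exact_order v (f * g) -> exact_order (v *m mxeval M f) g.
Proof.
move=> f0 vfg h; rewrite -mulmxA -mxevalM.
by split=> [/vfg|h']; [|apply/vfg]; rewrite dvdp_mul2l.
Qed.

Lemma exact_orderD v w f g :
  coprimep f g -> exact_order v f -> exact_order w g ->
  exact_order (v + w) (f * g).
Proof.
move=> fg vf wg h; rewrite Gauss_dvdp //; split; last first.
  by move=> /andP[/vf hv /wg hw]; rewrite mulmxDl hv hw addr0.
move=> e.
have ev : v *m mxeval M h = - (w *m mxeval M h).
  by apply/eqP; rewrite -addr_eq0 -mulmxDl e.
apply/andP; split.
  rewrite -(Gauss_dvdpl h fg); apply/vf; rewrite mxevalM mulmxA ev mulNmx.
  by rewrite -mulmxA mxevalMC mulmxA (iffRL (wg g)) ?mul0mx ?oppr0.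
rewrite coprimep_sym in fg; rewrite -(Gauss_dvdpl h fg); apply/wg.
rewrite mxevalM mulmxA -[w *m _]opprK -ev mulNmx.
by rewrite -mulmxA mxevalMC mulmxA (iffRL (vf f)) ?mul0mx ?oppr0.
Qed.

(** k collects the irreducible factors of h that do not divide c, and m those
    that do; repeated division by gcd(h, c) separates them without factoring
    into irreducibles. The last clause says that m has no irreducible factor
    outside those of c. *)
Lemma split_off_primes (c h : {poly F}) : h != 0 ->
  exists k m, [/\ h = k * m, coprimep k c
    & forall x, coprimep x c -> coprimep x m].
Proof.
have [s] := ubnP (size h); elim: s => // s IH in h *; rewrite ltnS => hs h0.
have [hc|hc] := boolP (coprimep h c).
  by exists h, 1; rewrite mulr1; split=> // x _; apply: coprimep1.
pose g := gcdp h c.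
have g0 : g != 0 by rewrite gcdp_eq0 negb_and h0.
have sg : (1 < size g)%N.
  move: hc; rewrite /coprimep -/g ltn_neqAle eq_sym => ->.
  by rewrite lt0n size_poly_eq0.
have [h' hE] : exists h', h = h' * g by apply/dvdpP/dvdp_gcdl.
have h'0 : h' != 0 by apply: contraNneq h0 => e; rewrite hE e mul0r.
have [|//|k [m [h'E kc mc]]] := IH h'.
  rewrite (leq_trans _ hs) // hE size_mul //.
  by rewrite -subn1 ltn_subRL addnC ltn_add2l.
exists k, (m * g); split=> // [|x xc]; first by rewrite mulrA -h'E.
rewrite coprimepMr mc //= (coprimep_dvdl (dvdp_gcdr h c)) //.
Qed.

(** The lcm of two orders is again an order. Write f = f1 h and g = c h with
    h = gcd(f, g), and h = k m where m carries the primes of c. Then f1 k and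
    m c are coprime orders of vectors derived from v and w, so their product,
    which is f c, is the order of the sum; and c is not constant as g does not
    divide f. *)
Lemma enlarge_order v w f g : f != 0 -> g != 0 ->
  exact_order v f -> exact_order w g -> ~~ (g %| f) ->
  exists u f', [/\ exact_order u f', f' != 0 & (size f < size f')%N].
Proof.
move=> f0 g0 vf wg gf.
pose h := gcdp f g.
have h0 : h != 0 by rewrite gcdp_eq0 negb_and f0.
have [f1 fE] : exists f1, f = f1 * h by apply/dvdpP/dvdp_gcdl.
have [c gE] : exists c, g = c * h by apply/dvdpP/dvdp_gcdr.
have f1c : coprimep f1 c.
  have := coprimep_div_gcd (p := f) (q := g); rewrite f0 => /(_ isT).
  have -> : f %/ gcdp f g = f1 by rewrite -/h fE mulpK.
  by have -> : g %/ gcdp f g = c by rewrite -/h gE mulpK.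
have [k [m [hE kc mc]]] := split_off_primes c h0.
have [f10 c0] : f1 != 0 /\ c != 0.
  by split; [move: f0; rewrite fE|move: g0; rewrite gE];
    rewrite mulf_eq0 negb_or => /andP[].
have [k0 m0] : k != 0 /\ m != 0.
  by move: h0; rewrite hE mulf_eq0 negb_or => /andP.
have vf' : exact_order (v *m mxeval M m) (f1 * k).
  apply: exact_order_shift => //; rewrite mulrC -mulrA -hE -fE //.
have wg' : exact_order (w *m mxeval M k) (m * c).
  apply: exact_order_shift => //; rewrite mulrA -hE mulrC -gE //.
exists (v *m mxeval M m + w *m mxeval M k), (f1 * k * (m * c)); split.
- apply: exact_orderD => //.
  have fkc : coprimep (f1 * k) c by rewrite coprimepMl f1c.
  by rewrite coprimepMr fkc mc.
- by rewrite !mulf_neq0.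
have -> : f1 * k * (m * c) = f * c by rewrite fE hE !mulrA.
rewrite size_mul // -subn1 ltn_subRL addnC ltn_add2l.
rewrite ltnNge; apply: contra gf => /size1_polyC cE.
rewrite gE cE mul_polyC dvdpZl ?dvdp_gcdl //.
by apply: contraNneq c0 => e; rewrite cE e polyC0.
Qed.

(** Orders divide every polynomial annihilating M, so enlarging them must stop;
    it stops only at an order that annihilates M. *)
Lemma cyclic_vector_exists :
  exists v, exists2 p, p != 0 &
    exact_order v p /\ mxeval M p = 0.
Proof.
have [p p0 pM] := annihilator_exists M.
have step m : exists v f, [/\ f != 0, exact_order v f
    & mxeval M f = 0 \/ (m <= size f)%N].
  elim: m => [|m [v [f [f0 vf fm]]]].
    by have [f f0 vf] := exact_order_exists 0; exists 0, f; split=> //; right.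
  have [fM|fM] := eqVneq (mxeval M f) 0; first by exists v, f; split=> //; left.
  case: fm => [/eqP|fm]; first by rewrite (negPf fM).
  have [w wfM] : exists w : 'rV_n, w *m mxeval M f != 0.
    have /matrix0Pn[i [j fij]] := fM.
    exists (delta_mx 0 i); rewrite -rowE; apply: contraNneq fij => e.
    by have := congr1 (fun u : 'rV_n => u 0 j) e; rewrite !mxE => ->.
  have [g g0 wg] := exact_order_exists w.
  have gf : ~~ (g %| f) by apply: contra wfM => /wg ->.
  have [u [f' [uf' f'0 sf]]] := enlarge_order f0 g0 vf wg gf.
  by exists u, f'; split=> //; right; apply: leq_trans sf.
have [v [f [f0 vf []]]] := step (size p).+1; first by exists v, f.
have /dvdp_leq -/(_ p0) : f %| p by apply/vf; rewrite pM mulmx0.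
by rewrite leqNgt => /negPf ->.
Qed.

End CyclicVector.

(** * Matrices similar to their inverses *)
Section TwoInvolutions.
Variable F : fieldType.

Definition mxinvol n (S : 'M[F]_n) : Prop := S *m S = 1%:M.

Definition two_invols n (M : 'M[F]_n) : Prop :=
  exists a b, [/\ mxinvol a, mxinvol b & M = a *m b].

Lemma mxinvol_sim m n (P : 'M[F]_(m, n)) Q a :
  P *m Q = 1%:M -> Q *m P = 1%:M -> mxinvol a -> mxinvol (P *m a *m Q).
Proof.
move=> PQ QP aa; rewrite /mxinvol !mulmxA -(mulmxA _ Q P) QP mulmx1.
by rewrite -(mulmxA P a a) aa mulmx1.
Qed.

Lemma mxinvol_dsum m n (a : 'M[F]_m) (b : 'M[F]_n) :
  mxinvol a -> mxinvol b -> mxinvol (dsum a b).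
Proof.
by rewrite /mxinvol /dsum mul_dsum => -> ->; rewrite -scalar_mx_block.
Qed.

Lemma two_invols_sim m n (A : 'M[F]_m) (B : 'M[F]_n) :
  msim A B -> two_invols B -> two_invols A.
Proof.
case=> P [Q [PQ QP ->]] [a [b [aa bb ->]]].
exists (P *m a *m Q), (P *m b *m Q); split; try exact: mxinvol_sim.
by rewrite !mulmxA -(mulmxA _ Q P) QP mulmx1.
Qed.

Lemma two_invols_dsum m n (A : 'M[F]_m) (B : 'M[F]_n) :
  two_invols A -> two_invols B -> two_invols (dsum A B).
Proof.
case=> a [b [aa bb ->]] [a' [b' [aa' bb' ->]]].
exists (dsum a a'), (dsum b b'); split; try exact: mxinvol_dsum.
by rewrite /dsum mul_dsum.
Qed.

(** C = s (s C), where s C is an involution because s C s = C^-1. *)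
Lemma two_invols_reversible n (C D s : 'M[F]_n) :
  C *m D = 1%:M -> mxinvol s -> C *m s = s *m D -> two_invols C.
Proof.
move=> CD ss Cs; have sDs : s *m D *m s = C by rewrite -Cs -mulmxA ss mulmx1.
exists s, (D *m s); split=> //; last by rewrite mulmxA sDs.
by rewrite /mxinvol !mulmxA -(mulmxA D s D) -(mulmxA D) sDs; apply: mulmx1C.
Qed.

(** The Krylov rows up to the degree of an annihilating polynomial p span all
    v f(M): reduce f modulo p. *)
Lemma mul_krylov_mod n (M : 'M[F]_n) (v : 'rV[F]_n) d p f :
  mxeval M p = 0 -> p != 0 -> (size p <= d.+1)%N ->
  v *m mxeval M f = poly_rV (f %% p) *m krylov M v d.
Proof.
move=> pM p0 sp; rewrite mul_krylov poly_rV_K.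
  by rewrite {1}(divp_eq f p) mxevalD mxevalM pM mulmx0 add0r.
by rewrite -ltnS (leq_trans _ sp) // ltn_modpN0.
Qed.

Lemma krylov_stable n (M : 'M[F]_n) (v : 'rV[F]_n) d p :
  mxeval M p = 0 -> p != 0 -> (size p <= d.+1)%N ->
  exists C, krylov M v d *m M = C *m krylov M v d.
Proof.
move=> pM p0 sp; exists (\matrix_(i < d) poly_rV (('X^i * 'X) %% p)).
apply/row_matrixP => i; rewrite !row_mul !rowK.
by rewrite -(mul_krylov_mod _ _ pM) // mxevalM mxevalX mulmxA.
Qed.

(** C is multiplication by X on F[X]/(p) in the basis of powers of X, D is
    multiplication by 1/X, and s is the map f(X) |-> f(1/X), which is well
    defined because p also annihilates D. *)
Lemma cyclic_reversal d (C D : 'M[F]_d) (v : 'rV[F]_d) p :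
  C *m D = 1%:M -> krylov C v d = 1%:M -> mxeval C p = 0 -> mxeval D p = 0 ->
  p != 0 -> (size p <= d.+1)%N ->
  exists2 s, mxinvol s & C *m s = s *m D.
Proof.
move=> CD KC pC pD p0 sp; pose s := krylov D v d.
have key f : v *m mxeval C f *m s = v *m mxeval D f.
  rewrite (mul_krylov_mod v f pC p0 sp) (mul_krylov_mod v f pD p0 sp).
  by rewrite KC mulmx1.
have rowC i m (B : 'M[F]_(d, m)) : row i B = v *m mxeval C 'X^i *m B.
  by rewrite rowE -row1 -KC rowK.
have Cs : C *m s = s *m D.
  apply/row_matrixP => i; rewrite rowC row_mul rowK.
  rewrite mulmxA -(mulmxA v) -{2}(mxevalX C) -mxevalM key mxevalM mxevalX.
  by rewrite mulmxA.
have sC : D *m s = s *m C.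
  have DC := mulmx1C CD.
  by rewrite -[D *m s]mulmx1 -DC !mulmxA -(mulmxA D s D) -Cs !mulmxA DC mul1mx.
exists s => //; apply/row_matrixP => i.
rewrite row_mul rowK -mulmxA (mxeval_intertwine _ sC) mulmxA.
have -> : v *m s = v by have := key 1; rewrite !mxeval1 !mulmx1.
by rewrite rowC mulmx1.
Qed.

Lemma mxeval_tr n (M : 'M[F]_n) f : mxeval M^T f = (mxeval M f)^T.
Proof.
elim/poly_ind: f => [|f c IH]; first by rewrite !mxeval0 trmx0.
rewrite {1}mulrC !mxevalD !mxevalM !mxevalX !mxevalC raddfD /= tr_scalar_mx.
by rewrite trmx_mul IH.
Qed.

(** Compression K M Y is multiplicative as soon as one factor preserves the
    splitting. *)
Lemma compress_mul d n (K : 'M[F]_(d, n)) Y M N :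
  K *m Y = 1%:M -> Y *m K *m M = M *m (Y *m K) ->
  (K *m M *m Y) *m (K *m N *m Y) = K *m (M *m N) *m Y.
Proof.
move=> KY eM; rewrite !mulmxA -(mulmxA _ Y K) -(mulmxA K M) -eM.
by rewrite !mulmxA KY mul1mx.
Qed.

Lemma compress_intertwine d n (K : 'M[F]_(d, n)) Y M :
  K *m Y = 1%:M -> Y *m K *m M = M *m (Y *m K) ->
  (K *m M *m Y) *m K = K *m M.
Proof.
by move=> KY eM; rewrite -!mulmxA -eM !mulmxA KY mul1mx.
Qed.

(** The classical complement of a cyclic subspace of maximal order: choose a
    linear form phi that vanishes on v, v M, ..., v M^(d-2) but not on
    v M^(d-1). The Hankel matrix of the v M^(i+j) phi is then invertible, so
    the M-stable subspace where all the forms M^j phi vanish is a complement of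
    the Krylov space of v. *)
Lemma cyclic_summand d n (M : 'M[F]_n) v p :
  exact_order M v p -> mxeval M p = 0 -> p != 0 -> size p = d.+1 ->
  exists2 Y : 'M[F]_(n, d), krylov M v d *m Y = 1%:M &
    Y *m krylov M v d *m M = M *m (Y *m krylov M v d).
Proof.
move=> vp pM p0 sp; set K := krylov M v d.
have Kf : row_free K.
  rewrite -kermx_eq0; apply/rowV0P => a /sub_kermxP.
  rewrite mul_krylov => /vp /dvdp_leq; rewrite sp => h; apply/eqP.
  apply: contraT => a0; have : rVpoly a != 0.
    by apply: contraNneq a0 => f0; rewrite -[a]rVpolyK f0 linear0.
  by move=> /h; rewrite ltnNge size_poly.
case: d => [|d] in K Kf sp *.
  by exists 0; [rewrite [LHS]flatmx0 [RHS]flatmx0 | rewrite !mul0mx mulmx0].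
pose phi : 'cV[F]_n := pinvmx K *m delta_mx ord_max 0.
have phiE (f : {poly F}) :
    (size f <= d.+1)%N -> (v *m mxeval M f *m phi) 0 0 = f`_d.
  move=> sf; rewrite -(poly_rV_K sf) -mul_krylov -/K mulmxA mulmxKp //.
  rewrite poly_rV_K //.
  by rewrite -colE !mxE.
(* The columns of L are the M^j phi, so that K L is the Hankel matrix. *)
pose L := (krylov M^T phi^T d.+1)^T.
have LE (x : 'rV[F]_n) j : (x *m L) 0 j = (x *m mxeval M 'X^j *m phi) 0 0.
  have <- : col j (x *m L) = x *m mxeval M 'X^j *m phi; last first.
    by rewrite [RHS]mxE.
  rewrite colE -mulmxA -colE -tr_row rowK mxeval_tr -trmx_mul trmxK.
  by rewrite mulmxA.
have uKL : K *m L \in unitmx.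
  rewrite -row_free_unit -kermx_eq0; apply/rowV0P => x /sub_kermxP xKL.
  have [f0|f0] := eqVneq (rVpoly x) 0.
    by rewrite -[x]rVpolyK f0 linear0.
  pose f := rVpoly x; have sf : (size f <= d.+1)%N by apply: size_poly.
  have sf0 : (0 < size f)%N by rewrite size_poly_gt0.
  (* This exponent brings the leading coefficient of f to degree d. *)
  have lt : (d - (size f).-1 < d.+1)%N by rewrite ltnS leq_subr.
  have := congr1 (fun u : 'rV_d.+1 => u 0 (Ordinal lt)) xKL.
  rewrite mulmxA mul_krylov LE -(mulmxA v) -mxevalM phiE; last first.
    rewrite (leq_trans (size_polyMleq _ _)) // size_polyXn addnS /=.
    case: (size f) sf sf0 => // k; rewrite ltnS => kd _.
    by rewrite addSn subnKC.
  rewrite coefMXn /= ltnNge leq_subr /= mxE subKn => [/eqP|].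
    by rewrite -lead_coefE lead_coef_eq0 (negPf f0).
  by rewrite -ltnS prednK.
have [C KC] : exists C, K *m M = C *m K.
  by apply: krylov_stable pM p0 _; rewrite sp.
have [C' LC] : exists C, M *m L = L *m C.
  have [D e] :
      exists D, krylov M^T phi^T d.+1 *m M^T = D *m krylov M^T phi^T d.+1.
    by apply: (krylov_stable _ _ p0); rewrite ?sp // mxeval_tr pM trmx0.
  by exists D^T; rewrite /L -[M in M *m _]trmxK -!trmx_mul e.
exists (L *m invmx (K *m L)); first by rewrite mulmxA mulmxV.
set G := invmx _; have GC : C' *m G = G *m C.
  rewrite -[LHS]mul1mx -(mulVmx uKL) -/G -!mulmxA; congr (_ *m _).
  rewrite (mulmxA L) -LC -mulmxA (mulmxA K) KC -mulmxA (mulmxA K L) mulmxV //.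
  by rewrite mulmx1.
by rewrite -!mulmxA KC !mulmxA LC -(mulmxA L C') GC !mulmxA.
Qed.

(** The hypothesis on ranks is implied by similarity of M and N = M^-1 and,
    unlike it, obviously passes to a summand when the other summand has it. It
    also shows that M and N have the same annihilating polynomials, hence that
    the cyclic summand of maximal order is reversed. *)
Lemma selfdual_rank_two_invols n (M N : 'M[F]_n) :
  M *m N = 1%:M -> (forall f, \rank (mxeval M f) = \rank (mxeval N f)) ->
  two_invols M.
Proof.
have [s] := ubnP n; elim: s => // s IH in n M N *; rewrite ltnS => ns MN rMN.
have [n0|n0] := posnP n.
  subst n; exists 1%:M, 1%:M; rewrite /mxinvol mulmx1; split=> //.
  by rewrite [LHS]flatmx0 [RHS]flatmx0.
have [v [p p0 [vp pM]]] := cyclic_vector_exists M.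
have sp : (1 < size p)%N.
  rewrite ltnNge; apply/negP => /size1_polyC pE; move: pM p0.
  rewrite pE mxevalC polyC_eq0 => /matrixP/(_ (Ordinal n0) (Ordinal n0)).
  by rewrite !mxE eqxx mulr1n => ->; rewrite eqxx.
have [d [spd d0]] : exists d, size p = d.+1 /\ (0 < d)%N.
  by exists (size p).-1; rewrite prednK ?(ltnW sp) // -ltnS prednK // ltnW.
have [Y KY eM] := cyclic_summand vp pM p0 spd.
set K := krylov M v d in KY eM.
have NM := mulmx1C MN.
have eN : Y *m K *m N = N *m (Y *m K).
  rewrite -[LHS]mul1mx -NM -(mulmxA N M) (mulmxA M) -eM -(mulmxA (Y *m K) M).
  by rewrite MN mulmx1.
have [r [Z [W [ZW KW ZY e1]]]] := complement_mx KY.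
have [PQ QP split] := split_commuting KY ZW KW ZY e1.
have WZ : W *m Z = 1%:M - Y *m K by rewrite -e1 addrAC subrr add0r.
have cWZ A : Y *m K *m A = A *m (Y *m K) -> W *m Z *m A = A *m (W *m Z).
  by move=> eA; rewrite WZ mulmxBl mulmxBr mul1mx mulmx1 eA.
have CD : K *m M *m Y *m (K *m N *m Y) = 1%:M.
  by rewrite compress_mul // MN mulmx1.
have MN2 : Z *m M *m W *m (Z *m N *m W) = 1%:M.
  by rewrite compress_mul ?cWZ // MN mulmx1.
have := split _ eM; have := split _ eN.
set C := K *m M *m Y in CD *; set D := K *m N *m Y in CD *.
set M2 := Z *m M *m W in MN2 *; set N2 := Z *m N *m W in MN2 *.
move=> simN simM.
have CK : C *m K = K *m M by apply: compress_intertwine.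
have DK : D *m K = K *m N by apply: compress_intertwine.
have Kf : row_free K by apply/row_freeP; exists Y.
have pK (A : 'M[F]_n) B : B *m K = K *m A -> mxeval A p = 0 -> mxeval B p = 0.
  move=> BK pA; apply: (row_free_inj Kf).
  by rewrite /= (mxeval_intertwine p BK) pA mulmx0 mul0mx.
have pN : mxeval N p = 0.
  by apply/eqP; rewrite -mxrank_eq0 -rMN pM mxrank0.
have [s' ss Cs] : exists2 s, mxinvol s & C *m s = s *m D.
  pose e0 : 'rV[F]_d := v *m Y.
  have e0K : e0 *m K = v.
    have vE : v = row (Ordinal d0) K by rewrite rowK /= mxeval1 mulmx1.
    by rewrite /e0 {1 2}vE -row_mul KY row1 -rowE.
  apply: (@cyclic_reversal _ C D e0 p) => //; last by rewrite spd.
  - apply: (row_free_inj Kf); rewrite /= mul1mx; apply/row_matrixP => i.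
    by rewrite row_mul !rowK -mulmxA (mxeval_intertwine _ CK) mulmxA e0K.
  - exact: pK CK pM.
  - exact: pK DK pN.
have rCD f : \rank (mxeval C f) = \rank (mxeval D f).
  have eC : C = s' *m D *m s' by rewrite -Cs -mulmxA ss mulmx1.
  exact: mxrank_sim (ss) ss (mxeval_sim f ss ss eC).
have n_dr : n = (d + r)%N.
  by apply/eqP; rewrite eqn_leq (mulmx1_min PQ) (mulmx1_min QP).
apply: (two_invols_sim (B := dsum C M2)).
  by exists (row_mx Y W), (col_mx K Z).
apply: two_invols_dsum; first exact: two_invols_reversible CD ss Cs.
apply: (IH _ M2 N2) => // [|f].
  by rewrite (leq_trans _ ns) // n_dr -[X in (X < _)%N]add0n ltn_add2r.
have := rMN f.
rewrite (mxrank_sim PQ QP (mxeval_sim f PQ QP simM)).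
rewrite (mxrank_sim PQ QP (mxeval_sim f PQ QP simN)).
by rewrite !mxeval_dsum /dsum !rank_diag_block_mx rCD => /addnI.
Qed.

End TwoInvolutions.

(** * Matrices with eigenvalues 1 and -1 *)
Section UnitSpectrum.
Variable F : fieldType.

Lemma msim_inverse_two_invols n (M N : 'M[F]_n) :
  M *m N = 1%:M -> msim M N -> two_invols M.
Proof.
move=> MN [P [Q [PQ QP e]]]; apply: selfdual_rank_two_invols MN _ => f.
exact: mxrank_sim PQ QP (mxeval_sim f PQ QP e).
Qed.

(** All eigenvalues in an algebraic closure are 1 or -1. Nilpotency of T^2 - 1
    expresses this over F, in any characteristic. *)
Definition spectrum_pm1 n (T : 'M[F]_n) : Prop :=
  exists k, mxeval T (('X^2 - 1) ^+ k) = 0.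

Lemma spectrum_pm1_sim m n (A : 'M[F]_m) (B : 'M[F]_n) :
  msim A B -> spectrum_pm1 B -> spectrum_pm1 A.
Proof.
case=> P [Q [PQ QP e]] [k Bk]; exists k.
by rewrite (mxeval_sim _ PQ QP e) Bk mulmx0 mul0mx.
Qed.

Lemma spectrum_pm1_tr n (T : 'M[F]_n) : spectrum_pm1 T -> spectrum_pm1 T^T.
Proof. by case=> k Tk; exists k; rewrite mxeval_tr Tk trmx0. Qed.

(** f(T) kills the first block of coordinates on one side and g(T) kills the
    second one on the other side. *)
Lemma mxeval_ublock_eq0 m n (A : 'M[F]_m) B (D : 'M[F]_n) f g :
  mxeval A f = 0 -> mxeval D g = 0 -> mxeval (block_mx A B 0 D) (f * g) = 0.
Proof.
move=> Af Dg; set T := block_mx A B 0 D.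
(* u and v are the inclusion of the first summand and the projection onto
   the second. *)
pose u : 'M[F]_(m + n, m) := col_mx 1%:M 0.
pose v : 'M[F]_(n, m + n) := row_mx 0 1%:M.
have Tu : T *m u = u *m A.
  rewrite /T /u mul_block_col mul_col_mx !mulmx0 !mulmx1 !addr0.
  by rewrite mul1mx mul0mx.
have vT : D *m v = v *m T.
  rewrite /T /v mul_row_block mul_mx_row !mulmx0 !mul0mx mulmx1 !add0r.
  by rewrite mul1mx.
have fu : mxeval T f *m u = 0 by rewrite (mxeval_intertwine f Tu) Af mulmx0.
have vg : v *m mxeval T g = 0 by rewrite -(mxeval_intertwine g vT) Dg mul0mx.
have e1 : u *m row_mx 1%:M 0 + col_mx 0 1%:M *m v = 1%:M.
  rewrite /u /v !mul_col_row !mulmx1 !mulmx0 add_block_mx !addr0 !add0r.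
  by rewrite -scalar_mx_block.
rewrite mxevalM -[X in X *m _]mulmx1 -e1 mulmxDr mulmxDl !mulmxA fu.
by rewrite !mul0mx add0r -mulmxA vg mulmx0.
Qed.

Lemma spectrum_pm1_ublock m n (A : 'M[F]_m) B (D : 'M[F]_n) :
  spectrum_pm1 A -> spectrum_pm1 D -> spectrum_pm1 (block_mx A B 0 D).
Proof.
by move=> [k Ak] [l Dl]; exists (k + l)%N; rewrite exprD mxeval_ublock_eq0.
Qed.

Lemma mxeval_coprime_unit n (T : 'M[F]_n) f q :
  coprimep f q -> mxeval T q = 0 ->
  exists h, mxeval T h *m mxeval T f = 1%:M.
Proof.
move=> /Bezout_eq1_coprimepP[[h h'] /= e] Tq; exists h.
by rewrite -mxevalM -(mxeval1 T) -e mxevalD (mxevalM T h' q) Tq mulmx0 addr0.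
Qed.

Lemma mxeval_exp_eq n (A : 'M[F]_n) (T : 'M[F]_n) f g k :
  mxeval A f = mxeval T g -> mxeval A (f ^+ k) = mxeval T (g ^+ k).
Proof.
move=> e; elim: k => [|k IH]; first by rewrite !expr0 !mxeval1.
by rewrite !exprS !mxevalM IH e.
Qed.

Lemma coprime_root_pm1 (g : {poly F}) k :
  ~~ root g 1 -> ~~ root g (-1) -> coprimep g (('X^2 - 1) ^+ k).
Proof.
move=> g1 gN1; apply: coprimep_expr.
have -> : 'X^2 - 1 = ('X - 1%:P) * ('X - (-1)%:P) :> {poly F}.
  by rewrite polyCN opprK polyC1 -subr_sqr expr1n.
by rewrite coprimepMr !coprimep_XsubC g1.
Qed.

Lemma mxrank_mulmx_unit n (U A V : 'M[F]_n) :
  V *m U = 1%:M -> \rank (A *m U) = \rank A.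
Proof.
move=> VU; apply: mxrankMfree; rewrite row_free_unit.
by case/mulmx1_unit: VU.
Qed.

(** T need not be assumed similar to T^-1. Write
    f = (X - 1)^a (X + 1)^b g with g(1), g(-1) nonzero. Both g(T) and g(T^-1)
    are invertible, and T^-1 - 1 = - T^-1 (T - 1), T^-1 + 1 = T^-1 (T + 1), so
    f(T) and f(T^-1) differ by invertible factors only. *)
Lemma spectrum_pm1_two_invols n (T : 'M[F]_n) : spectrum_pm1 T -> two_invols T.
Proof.
case=> k Tk.
have cX : coprimep 'X (('X^2 - 1) ^+ k : {poly F}).
  apply: coprimep_expr; rewrite -[X in coprimep X]subr0 -polyC0 coprimep_sym.
  by rewrite coprimep_XsubC rootE !hornerE expr0n sub0r oppr_eq0 oner_eq0.
have [h hT] := mxeval_coprime_unit cX Tk; rewrite mxevalX in hT.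
set N := mxeval T h in hT; have TN := mulmx1C hT.
apply: selfdual_rank_two_invols TN _ => f.
have [->|f0] := eqVneq f 0; first by rewrite !mxeval0.
have [a [f1 /implyP/(_ f0) f11 ef]] := multiplicity_XsubC f 1.
have f10 : f1 != 0 by apply: contraNneq f0 => e; rewrite ef e mul0r.
have [b [g /implyP/(_ f10) gN1 ef1]] := multiplicity_XsubC f1 (-1).
have g1 : ~~ root g 1 by apply: contra f11; rewrite ef1 rootM => ->.
have cg := coprime_root_pm1 k g1 gN1.
have NX : mxeval N ('X - 1%:P) = mxeval T (- h * ('X - 1%:P)).
  rewrite mulNr mulrBr opprB !mxevalB !mxevalM mxevalX !mxevalC mulmx1.
  by rewrite mxevalX hT.
have NX' : mxeval N ('X - (-1)%:P) = mxeval T (h * ('X - (-1)%:P)).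
  rewrite polyCN opprK mulrDr !mxevalD !mxevalM mxevalX !mxevalC mulmx1.
  by rewrite mxevalX hT addrC.
have Nk : mxeval N (('X^2 - 1) ^+ k) = 0.
  have e : mxeval N ('X^2 - 1) = mxeval T (- h ^+ 2 * ('X^2 - 1)).
    rewrite !expr2 mulNr mulrBr opprB mulr1 !mxevalB !mxevalM !mxevalX mxeval1.
    by rewrite -/N mulmxA -[N *m N *m T]mulmxA hT mulmx1 hT.
  by rewrite (mxeval_exp_eq k e) exprMn mxevalM Tk mulmx0.
have [u uT] := mxeval_coprime_unit cg Tk.
have [w wN] := mxeval_coprime_unit cg Nk.
rewrite ef ef1 -mulrA mulrC (mxevalM T) (mxevalM N).
rewrite (mxrank_mulmx_unit _ uT) (mxrank_mulmx_unit _ wN).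
rewrite (mxevalM N) (mxeval_exp_eq a NX) (mxeval_exp_eq b NX') !exprMn.
rewrite -mxevalM mulrACA [h ^+ b * _ * _]mulrC [in RHS]mxevalM.
rewrite (mxrank_mulmx_unit _ (V := mxeval T ('X ^+ b * (- 'X) ^+ a))) //.
rewrite -mxevalM mulrACA -!exprMn mulrNN.
rewrite -exprD (mxeval_exp_eq (g := 1) _ (A := T) (T := T)).
  by rewrite expr1n mxeval1.
by rewrite mulrC mxevalM mxevalX mxeval1.
Qed.

End UnitSpectrum.

(** * Factoring nonscalar matrices *)
Section NonscalarFactorization.
Variable F : fieldType.

Lemma msim_size m n (A : 'M[F]_m) (B : 'M[F]_n) : msim A B -> m = n.
Proof.
case=> P [Q [PQ QP _]].
by apply/eqP; rewrite eqn_leq (mulmx1_min PQ) (mulmx1_min QP).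
Qed.

Lemma msim_det m n (A : 'M[F]_m) (B : 'M[F]_n) : msim A B -> \det A = \det B.
Proof.
move=> simAB; have e := msim_size simAB; move: simAB; subst n.
case=> P [Q [PQ _ ->]]; rewrite !det_mulmx mulrAC -det_mulmx PQ det1 mul1r.
by [].
Qed.

(** A matrix for which every e_i and every e_0 + e_i is an eigenvector is
    scalar. *)
Lemma nonscalar_moved_vector n (A : 'M[F]_n) :
  ~~ is_scalar_mx A -> exists u : 'rV[F]_n, ~~ (u *m A <= u)%MS.
Proof.
move=> nsA.
have [/existsP[i /existsP[j /andP[ij Aij]]]|] :=
    boolP [exists i, [exists j, (i != j) && (A i j != 0)]].
  exists (delta_mx 0 i); apply: contra Aij => /sub_rVP[a /rowP/(_ j)].
  by rewrite -rowE !mxE eqxx eq_sym (negPf ij) mulr0 => ->.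
rewrite negb_exists => /forallP off.
have {}off i j : i != j -> A i j = 0.
  move=> ij; have := off i; rewrite negb_exists => /forallP/(_ j).
  by rewrite ij negbK => /eqP.
case: n A nsA off => [|n] A nsA off.
  case/negP: nsA; apply/is_scalar_mxP; exists 0.
  by rewrite [LHS]flatmx0 [RHS]flatmx0.
have [i Ai] : exists i, A i i != A 0 0.
  apply/existsP; apply: contraR nsA; rewrite negb_exists => /forallP all0.
  apply/is_scalar_mxP; exists (A 0 0); apply/matrixP=> i j; rewrite !mxE.
  by have [<-|/off->] := eqVneq i j; [have := all0 i; rewrite negbK => /eqP|].
have i0 : i != 0 by apply: contraNneq Ai => ->.
exists (delta_mx 0 0 + delta_mx 0 i); apply: contra Ai => /sub_rVP[a e].
have := congr1 (fun x : 'rV_n.+1 => x 0 i) e.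
have := congr1 (fun x : 'rV_n.+1 => x 0 0) e.
have i0' : 0 != i by rewrite eq_sym.
rewrite mulmxDl -!rowE !mxE !eqxx (off i 0) // (off 0 i) //.
by rewrite (negPf i0) (negPf i0') !addr0 !add0r !mulr1 => -> ->.
Qed.

(** If u is not an eigenvector, there is a linear form phi with
    u phi = u A phi = 1. In a basis made of u and of a basis of ker phi the
    upper left entry of A is 1, and r = 0 would make u an eigenvector. *)
Lemma nonscalar_pivot n (A : 'M[F]_n) :
  ~~ is_scalar_mx A ->
  exists m (r : 'rV[F]_m) (s : 'cV[F]_m) (D : 'M[F]_m),
    msim A (block_mx 1%:M r s D) /\ r != 0.
Proof.
case/nonscalar_moved_vector=> u uA.
have [phi [uphi uAphi]] :
    exists phi : 'cV[F]_n, u *m phi = 1%:M /\ u *m A *m phi = 1%:M.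
  move: (uA); rewrite submxE => /matrix0Pn[i [j]]; rewrite ord1 {i} => psij.
  pose psi := col j (cokermx u).
  have upsi : u *m psi = 0 by rewrite /psi colE mulmxA mulmx_coker mul0mx.
  pose t := (u *m A *m psi) 0 0.
  have t0 : t != 0 by rewrite /t /psi colE mulmxA -colE mxE.
  have /matrix0Pn[i [k]] : u != 0.
    by apply: contraNneq uA => ->; rewrite mul0mx sub0mx.
  rewrite ord1 {i} => uk.
  have [chi uchi] : exists chi : 'cV[F]_n, u *m chi = 1%:M.
    exists ((u 0 k)^-1 *: delta_mx k 0).
    by rewrite -scalemxAr -colE; apply/matrixP=> a b; rewrite !ord1 !mxE mulVf.
  (* chi has the right value at u, and psi corrects the value at u A. *)
  exists (chi + (t^-1 * (1 - (u *m A *m chi) 0 0)) *: psi).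
  rewrite !mulmxDr -!scalemxAr upsi scaler0 addr0 uchi; split=> //.
  apply/matrixP=> a b; rewrite !ord1 [LHS]mxE [X in _ + X]mxE -/t mulrAC.
  rewrite mulVf //.
  by rewrite mul1r addrC subrK mxE eqxx.
have [m [Z [W [ZW uW Zphi e1]]]] := complement_mx uphi.
exists m, (u *m A *m W), (Z *m A *m phi), (Z *m A *m W); split.
  exists (row_mx phi W), (col_mx u Z); split.
  - by rewrite mul_row_col.
  - by rewrite mul_col_row uphi uW Zphi ZW -scalar_mx_block.
  rewrite -{1}uAphi -mul_col_row -!mul_col_mx !mulmxA mul_row_col e1 mul1mx.
  by rewrite -mulmxA mul_row_col e1 mulmx1.
apply: contra uA => /eqP uAW.
by rewrite -[u *m A]mulmx1 -e1 mulmxDr !mulmxA uAphi uAW mul0mx addr0 mul1mx.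
Qed.

Lemma det_pivot m (r : 'rV[F]_m) (s : 'cV[F]_m) D :
  \det (block_mx 1%:M r s D) = \det (D - s *m r).
Proof.
have -> : block_mx 1%:M r s D =
    block_mx 1%:M 0 s 1%:M *m block_mx 1%:M r 0 (D - s *m r).
  by rewrite mulmx_block !mulmx0 !mul0mx !mul1mx !mulmx1 !addr0 addrC subrK.
by rewrite det_mulmx det_lblock det_ublock !det1 !mul1r.
Qed.

(** Suppose that the Schur complement is a scalar a. Conjugating by the
    transvection with lower left block mu, where r mu = 0, keeps the pivot and
    the row r and turns the Schur complement into a (1 + mu r), which is not
    scalar since mu r is nonzero of square zero. Such a nonzero mu exists as
    soon as there are at least two columns. *)
Lemma nonscalar_pivot_schur n (A : 'M[F]_n) :
  ~~ is_scalar_mx A -> \det A != 0 ->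
  exists m (r : 'rV[F]_m) (s : 'cV[F]_m) (D : 'M[F]_m),
    msim A (block_mx 1%:M r s D) /\
    ((m <= 1)%N || ~~ is_scalar_mx (D - s *m r)).
Proof.
move=> nsA dA; have [m [r [s [D [simA r0]]]]] := nonscalar_pivot nsA.
have [m1|m1] := leqP m 1; first by exists m, r, s, D; rewrite m1.
have [|ns] := boolP (is_scalar_mx (D - s *m r)); last first.
  by exists m, r, s, D; rewrite ns orbT.
case/is_scalar_mxP=> a Da.
have [mu mu0 rmu] : exists2 mu : 'cV[F]_m, mu != 0 & r *m mu = 0.
  have /matrix0Pn[i [j cij]] : cokermx r != 0.
    rewrite -mxrank_eq0 mxrank_coker subn_eq0 -ltnNge.
    by rewrite (leq_ltn_trans _ m1) // rank_leq_row.
  exists (col j (cokermx r)); last by rewrite colE mulmxA mulmx_coker mul0mx.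
  by apply: contraNneq cij => /matrixP/(_ i 0); rewrite !mxE => ->.
exists m, r, (s + mu - D *m mu), (D + mu *m r); split.
  apply: msim_trans simA _.
  exists (block_mx 1%:M 0 (- mu) 1%:M), (block_mx 1%:M 0 mu 1%:M).
  rewrite !mulmx_block !mulmx0 !mul0mx !mul1mx !mulmx1 !addr0 !add0r addNr.
  rewrite subrr -!scalar_mx_block; split=> //; congr block_mx.
  - by rewrite rmu addr0.
  - rewrite mulNmx [- (mu *m r) + _]addrCA addNr addr0 -addrA subrK.
    by rewrite addrCA addNr addr0.
  - by rewrite mulNmx addrCA addNr addr0.
apply/orP; right; apply/negP => /is_scalar_mxP[b eb].
have a0 : a != 0.
  apply: contraNneq dA => a0; rewrite (msim_det simA) det_pivot Da a0.
  by rewrite det_scalar expr0n gtn_eqF // ltnW.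
have DE : D = a%:M + s *m r by rewrite -Da subrK.
have Dmu : D *m mu = a *: mu.
  by rewrite DE mulmxDl -mulmxA rmu mulmx0 addr0 mul_scalar_mx.
have e : a *: (mu *m r) = (b - a)%:M.
  rewrite raddfB /= -eb -Da Dmu !mulmxDl mulNmx -scalemxAl.
  by rewrite [- (_ + _ - _)]opprB addrCA opprD addrACA subrr addr0 addrK.
have ba : b - a = 0.
  have : r *m (a *: (mu *m r)) = 0.
    by rewrite -scalemxAr mulmxA rmu mul0mx scaler0.
  rewrite e mul_mx_scalar => /eqP; rewrite scaler_eq0 (negPf r0) orbF.
  by move/eqP.
move/eqP: e; rewrite ba raddf0 scaler_eq0 (negPf a0) /= => /eqP mur.
have /matrix0Pn[i [j]] := r0; have /matrix0Pn[i' [j']] := mu0.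
rewrite !ord1 => mui rj.
have /matrixP/(_ i' j) := mur; rewrite !mxE big_ord1 => /eqP.
by rewrite mulf_eq0 (negPf mui) (negPf rj).
Qed.

(** LU factorization with prescribed diagonals: with a pivot equal to 1, a
    factorization of the Schur complement extends to one of A by triangular
    blocks with 1 in the corner. The determinant is left for the last step,
    where the size is 1. *)
Lemma nonscalar_factor n (A : 'M[F]_n) :
  \det A ^+ 2 = 1 -> (n <= 1)%N || ~~ is_scalar_mx A ->
  exists X Y, [/\ spectrum_pm1 X, spectrum_pm1 Y & A = X *m Y].
Proof.
have [k] := ubnP n; elim: k => // k IH in n A *; rewrite ltnS => nk dA.
have one_pm1 p : spectrum_pm1 (1%:M : 'M[F]_p).
  exists 1; rewrite expr1 expr2 mxevalB mxevalM mxevalX mxeval1 mulmx1.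
  by rewrite subrr.
have [n1 _|n1 /= nsA] := leqP n 1.
  exists A, 1%:M; rewrite mulmx1; split=> //.
  exists 1%N; rewrite expr1 expr2 mxevalB mxevalM mxevalX mxeval1.
  case: n n1 A dA {nk} => [|[|//]] _ A dA; first by rewrite [LHS]flatmx0.
  apply/matrixP=> i j; rewrite {1 2}[A]mx11_scalar -scalar_mxM -expr2.
  by rewrite -det_mx11 dA subrr.
have dA0 : \det A != 0.
  apply: contraPneq dA => ->; rewrite expr0n /= => /esym/eqP.
  by rewrite oner_eq0.
have [m [r [s [D [simA ns]]]]] := nonscalar_pivot_schur nsA dA0.
have [] := IH _ (D - s *m r) _ _ ns.
- by rewrite (leq_trans _ nk) // (msim_size simA).
- by rewrite -det_pivot -(msim_det simA).
move=> X [Y [pX pY e]]; case: simA => P [Q [PQ QP eA]].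
exists (P *m block_mx 1%:M 0 s X *m Q), (P *m block_mx 1%:M r 0 Y *m Q); split.
- apply: spectrum_pm1_sim; first by exists P, Q; split.
  rewrite -[block_mx _ _ _ _]trmxK; apply: spectrum_pm1_tr.
  rewrite tr_block_mx trmx0.
  by apply: spectrum_pm1_ublock; apply: spectrum_pm1_tr.
- apply: spectrum_pm1_sim; first by exists P, Q; split.
  exact: spectrum_pm1_ublock.
rewrite !mulmxA -(mulmxA _ Q P) QP mulmx1 eA -[in RHS](mulmxA P).
congr (_ *m _ *m _).
by rewrite mulmx_block !mulmx0 !mul0mx !mul1mx !mulmx1 !addr0 -e addrC subrK.
Qed.

End NonscalarFactorization.

(** * Factoring scalar matrices through weighted cyclic shifts *)
Section WeightedShift.
Variable F : fieldType.

Lemma msim_dsumC m n (A : 'M[F]_m) (B : 'M[F]_n) : msim (dsum A B) (dsum B A).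
Proof.
exists (block_mx 0 1%:M 1%:M 0), (block_mx 0 1%:M 1%:M 0).
rewrite /dsum !mulmx_block !mulmx0 !mul0mx !mulmx1 !mul1mx !addr0 !add0r.
by rewrite -!scalar_mx_block; split.
Qed.

Lemma msim_scale m n (A : 'M[F]_m) (B : 'M[F]_n) a :
  msim A B -> msim (a *: A) (a *: B).
Proof.
case=> P [Q [PQ QP ->]]; exists P, Q; split=> //.
by rewrite -scalemxAr -scalemxAl.
Qed.

Lemma msim_inverse m n (A A' : 'M[F]_m) (B B' : 'M[F]_n) :
  A *m A' = 1%:M -> B *m B' = 1%:M -> msim A B -> msim A' B'.
Proof.
move=> AA' BB' [P [Q [PQ QP e]]]; exists P, Q; split=> //.
have PBQ : A *m (P *m B' *m Q) = 1%:M.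
  rewrite e !mulmxA -(mulmxA _ Q P) QP mulmx1 -(mulmxA P) BB' mulmx1 //.
by rewrite -[RHS]mul1mx -(mulmx1C AA') -(mulmxA A') PBQ mulmx1.
Qed.

(** A solution Z of a Sylvester equation clears the corner. *)
Lemma msim_ublock m n (A : 'M[F]_m) (D : 'M[F]_n) B Z :
  Z *m D - A *m Z = B -> msim (block_mx A B 0 D) (dsum A D).
Proof.
move=> <-; exists (block_mx 1%:M Z 0 1%:M), (block_mx 1%:M (- Z) 0 1%:M).
rewrite /dsum !mulmx_block !mulmx0 !mul0mx !mulmx1 !mul1mx !addr0 !add0r.
rewrite addNr subrr -scalar_mx_block; split=> //.
by rewrite mulmxN [- _ + _]addrC mul0mx add0r.
Qed.

Variable n' : nat.
Local Notation n := n'.+1.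
Implicit Types x y a : F.

(** Addition is that of the integers modulo n, so this is the cyclic
    successor. *)
Definition next_ord (i : 'I_n) : 'I_n := i + inZp 1.

Lemma next_ordE i : val (next_ord i) = (i.+1 %% n)%N.
Proof. by rewrite /= modnDmr addn1. Qed.

(** Sends e_i to e_(i+1), and e_(n-1) to x e_0. *)
Definition wshift x : 'M[F]_n :=
  \matrix_(i, j) ((if i == ord_max then x else 1) *+ (j == next_ord i)).

(** Conjugating by the diagonal matrix of the powers of a absorbs the factor a
    at every step but the last one, where it accumulates to a^n. *)
Lemma wshift_scale a y :
  a != 0 -> msim (a *: wshift y) (wshift (y * a ^+ n)).
Proof.
move=> a0; pose E : 'M[F]_n := diag_mx (\row_i a ^+ i).
apply: (@msim_conj _ _ E).
  rewrite unitmxE det_diag unitfE; apply/prodf_neq0 => i _.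
  by rewrite mxE expf_neq0.
apply/matrixP => i j; rewrite mul_diag_mx mul_mx_diag !mxE.
have [->|_] := eqVneq j; last by rewrite !mulr0 mul0r.
rewrite next_ordE; have [->|ni] := eqVneq i ord_max.
  by rewrite /= modnn expr0 mulr1 !mulr1n mulrA -exprSr mulrC.
rewrite modn_small ?mulr1 ?mul1r -?exprSr //.
rewrite ltn_neqAle ltn_ord andbT; apply: contraNneq ni => e.
by apply/eqP/val_inj; case: e.
Qed.

Lemma wshift_row x i : (delta_mx 0 i : 'rV[F]_n) *m wshift x =
  (if i == ord_max then x else 1) *: delta_mx 0 (next_ord i).
Proof.
by apply/rowP=> j; rewrite -rowE !mxE eqxx mulr_natr.
Qed.

Lemma wshift_pow x : mxeval (wshift x) 'X^n = x%:M.
Proof.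
have low k (kn : (k < n)%N) :
    delta_mx 0 0 *m mxeval (wshift x) 'X^k = delta_mx 0 (Ordinal kn) :> 'rV_n.
  elim: k => [|k IH] in kn *.
    by rewrite mxeval1 mulmx1; congr delta_mx; apply: val_inj.
  have kn' := ltnW kn.
  rewrite exprSr mxevalM mxevalX mulmxA (IH kn') wshift_row -val_eqE /=.
  rewrite ltn_eqF // scale1r; congr delta_mx; apply: val_inj.
  by rewrite next_ordE /= modn_small.
have top : delta_mx 0 0 *m mxeval (wshift x) 'X^n = x *: delta_mx 0 0 :> 'rV_n.
  rewrite exprSr mxevalM mxevalX mulmxA (low _ (ltnSn n')) wshift_row.
  rewrite -val_eqE /= eqxx; congr (_ *: delta_mx _ _); apply: val_inj.
  by rewrite next_ordE modnn.
apply/row_matrixP => i; rewrite !rowE.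
have -> : delta_mx 0 i = delta_mx 0 0 *m mxeval (wshift x) 'X^i :> 'rV_n.
  by rewrite (low _ (ltn_ord i)); congr delta_mx; apply: val_inj.
by rewrite -mulmxA mxevalMC mulmxA top -scalemxAl mul_mx_scalar.
Qed.

(** i |-> i + 1 and i |-> i - 1 are conjugate under i |-> - i. *)
Lemma wshift1_sim_inverse V : wshift 1 *m V = 1%:M -> msim (wshift 1) V.
Proof.
pose pm (f : 'I_n -> 'I_n) : 'M[F]_n := \matrix_(i, j) (j == f i)%:R.
have pmM f g : pm f *m pm g = pm (g \o f).
  apply/matrixP=> i j; rewrite !mxE (bigD1 (f i)) //= !mxE eqxx mul1r.
  by rewrite big1 ?addr0 // => k /negPf kf; rewrite mxE kf mul0r.
have pm1 f : f =1 id -> pm f = 1%:M.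
  by move=> fE; apply/matrixP=> i j; rewrite !mxE fE eq_sym.
have -> : wshift 1 = pm next_ord by apply/matrixP=> i j; rewrite !mxE if_same.
pose prev i : 'I_n := i - inZp 1.
move=> WV; have -> : V = pm prev.
  rewrite -[LHS]mul1mx -(pm1 (next_ord \o prev)) => [|i]; last first.
    by rewrite /= /next_ord subrK.
  by rewrite -pmM -mulmxA WV mulmx1.
have JJ : pm -%R *m pm -%R = 1%:M by rewrite pmM pm1 // => i; rewrite /= opprK.
exists (pm -%R), (pm -%R); split=> //.
rewrite !pmM; apply/matrixP=> i j; rewrite !mxE /= /next_ord /prev.
by rewrite opprD !opprK.
Qed.

(** Put Y = dl X^-1 with dl = -d, X a shift of weight x. When x^2 <> dl^n, the
    matrices X and Y have no common eigenvalue and the triangular matrix is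
    similar to Y (+) X, with inverse dl^-1 X (+) X^-1. If dl^n = 1, multiplying
    a shift by dl or dl^-1 does not change its class, so Y is similar to X^-1
    and X to dl^-1 X. If dl^n = -1, take x = 1: then X is similar to X^-1, and
    Y and dl^-1 X are both similar to the shift of weight -1. *)
Lemma scalar_factor (d : F) : d ^+ 2 != 1 ->
  (d ^+ n) ^+ 2 = 1 ->
  exists X Y : 'M[F]_n, - d%:M = X *m Y /\ two_invols (block_mx Y 1%:M 0 X).
Proof.
move=> d1 dn; pose dl := - d.
have dl2 : (dl ^+ n) ^+ 2 = 1.
  by rewrite -exprM mulnC exprM sqrrN -exprM mulnC exprM.
(* Both requirements, x^2 <> dl^n and X (+) Y similar to its inverse, are met
   by x = d if dl^n = 1 and by x = 1 if dl^n = -1 <> 1. *)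
have [x [x0 xdl choice]] : exists x, [/\ x != 0, x ^+ 2 != dl ^+ n
    & dl ^+ n = 1 \/ dl ^+ n = -1 /\ x = 1].
  have /eqP := dl2; rewrite sqrf_eq1.
  have [e _|ne /= /eqP e] := eqVneq (dl ^+ n) 1.
    exists d; rewrite e; split=> //; last by left.
    by apply: contra_eq_neq dn => ->; rewrite !expr0n /= eq_sym oner_eq0.
  by exists 1; rewrite oner_eq0 expr1n eq_sym ne; split=> //; right.
have dl0 : dl != 0.
  by apply: contra_eq_neq dl2 => ->; rewrite !expr0n /= eq_sym oner_eq0.
set X := wshift x.
have [V XV VX] : exists2 V, X *m V = 1%:M & V *m X = 1%:M.
  exists (x^-1 *: mxeval X 'X^n').
    rewrite -scalemxAr -{1}(mxevalX X) -mxevalM -exprS wshift_pow.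
    by rewrite scale_scalar_mx mulVf.
  rewrite -scalemxAl -{2}(mxevalX X) -mxevalM -exprSr wshift_pow.
  by rewrite scale_scalar_mx mulVf.
exists X, (dl *: V); split.
  by rewrite -scalemxAr XV scalemx1 /dl raddfN.
have [h hX] : exists h, mxeval X h *m (X *m X - dl%:M) = 1%:M.
  pose c := x ^+ 2 - dl ^+ n; have c0 : c != 0 by rewrite subr_eq0.
  have e : mxeval X (('X^2) ^+ n - dl%:P ^+ n) = c%:M.
    rewrite exprAC mxevalB expr2 mxevalM wshift_pow -polyC_exp mxevalC.
    by rewrite -scalar_mxM -raddfB.
  (* X^2 - dl divides (X^2)^n - dl^n, whose value is the nonzero scalar c. *)
  move: e; rewrite subrXX mulrC mxevalM mxevalB expr2 mxevalM mxevalX mxevalC.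
  set g := \sum_(_ < _) _ => e; exists (c^-1 *: g).
  rewrite -mul_polyC mxevalM mxevalC -mulmxA e mul_scalar_mx.
  by rewrite scale_scalar_mx mulVf.
set H := mxeval X h in hX.
have HX : H *m X = X *m H by rewrite /H -{2 3}(mxevalX X) mxevalMC.
have simT : msim (block_mx (dl *: V) 1%:M 0 X) (dsum (dl *: V) X).
  apply: (@msim_ublock _ _ _ _ _ (H *m X)).
  rewrite -scalemxAl HX mulmxA VX mul1mx -HX -hX mulmxBr mulmxA.
  by rewrite mul_mx_scalar.
apply: two_invols_sim simT _.
have inv : dsum (dl *: V) X *m dsum (dl^-1 *: X) V = 1%:M.
  rewrite /dsum mul_dsum XV -scalemxAr -scalemxAl VX scalerA mulVf // scale1r.
  by rewrite -scalar_mx_block.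
apply: msim_inverse_two_invols inv _.
have XdX y : X = wshift y -> msim (dl^-1 *: X) (wshift (y * (dl^-1) ^+ n)).
  by move=> ->; apply: wshift_scale; rewrite invr_eq0.
case: choice => [dln|[dln x1]].
  have XX : msim (dl^-1 *: X) X.
    by have := XdX x erefl; rewrite exprVn dln invr1 mulr1.
  apply: msim_trans (msim_dsumC V (dl^-1 *: X)).
  apply: msim_dsum; last exact: msim_sym.
  apply: msim_inverse XX => //.
  by rewrite -scalemxAr -scalemxAl XV scalerA mulfV // scale1r.
have XV' : msim X V by move: XV; rewrite /X x1; apply: wshift1_sim_inverse.
apply: msim_dsum => //.
apply: msim_trans (msim_scale dl (msim_sym XV')) _.
apply: (msim_trans (B := wshift (-1))).
  by have := wshift_scale 1 dl0; rewrite -x1 -/X dln mulrN1 x1.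
apply: msim_sym; have := XdX x erefl.
by rewrite x1 mul1r exprVn dln invrN1.
Qed.

End WeightedShift.

(** * Three involutions, after stabilization *)
Section ThreeInvolutions.
Variable F : fieldType.

Definition three_invols n (M : 'M[F]_n) : Prop :=
  exists a b c, [/\ mxinvol a, mxinvol b, mxinvol c & M = a *m b *m c].

Lemma mxinvol1 n : mxinvol (1%:M : 'M[F]_n).
Proof. exact: mulmx1. Qed.

Lemma mul_invol_two_invols n (s T : 'M[F]_n) :
  mxinvol s -> two_invols T -> three_invols (s *m T).
Proof. by move=> ss [b [c [bb cc ->]]]; exists s, b, c; rewrite mulmxA. Qed.

Lemma three_invols_sim m n (A : 'M[F]_m) (B : 'M[F]_n) :
  msim A B -> three_invols B -> three_invols A.
Proof.
case=> P [Q [PQ QP ->]] [a [b [c [aa bb cc ->]]]].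
exists (P *m a *m Q), (P *m b *m Q), (P *m c *m Q).
split; try exact: mxinvol_sim.
by rewrite !mulmxA -!(mulmxA _ Q P) QP !mulmx1.
Qed.

Lemma three_invols_dsum m n (A : 'M[F]_m) (B : 'M[F]_n) :
  two_invols A -> three_invols B -> three_invols (dsum A B).
Proof.
case=> a [b [aa bb ->]] [a' [b' [c' [aa' bb' cc' ->]]]].
exists (dsum a a'), (dsum b b'), (dsum 1%:M c').
split; try by apply: mxinvol_dsum => //; apply: mxinvol1.
by rewrite /dsum !mul_dsum mulmx1.
Qed.

Lemma two_invols_det n (A : 'M[F]_n) : two_invols A -> \det A ^+ 2 = 1.
Proof.
case=> a [b [/(congr1 determinant) aa /(congr1 determinant) bb ->]].
move: aa bb; rewrite !det_mulmx det1 -!expr2 exprMn => -> ->.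
by rewrite mulr1.
Qed.

(** Fitting's lemma at the eigenvalue 1. An annihilating polynomial is
    (X - 1)^a g with g(1) nonzero, and Bezout gives the idempotent that cuts out
    the summand U with (U - 1)^a = 0. On the other summand g vanishes, which
    makes 1 - A0 invertible. *)
Lemma fitting_at_one n (A : 'M[F]_n) :
  exists n1 n2 (U : 'M[F]_n1) (A0 B0 : 'M[F]_n2),
    [/\ msim A (dsum U A0), spectrum_pm1 U & (1%:M - A0) *m B0 = 1%:M].
Proof.
have [q q0 qA] := annihilator_exists A.
have [a [g /implyP/(_ q0) g1 eq]] := multiplicity_XsubC q 1.
pose f : {poly F} := ('X - 1%:P) ^+ a.
have cXg : coprimep ('X - 1%:P) g by rewrite coprimep_sym coprimep_XsubC.
have /Bezout_eq1_coprimepP[[u w] /= uw] : coprimep f g by apply: coprimep_expl.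
have fgA t : mxeval A (t * (g * f)) = 0.
  by rewrite -[g * f]/(g * ('X - 1%:P) ^+ a) -eq mxevalM qA mulmx0.
pose e := mxeval A (w * g).
have e1 : 1%:M - e = mxeval A (u * f).
  by rewrite -(mxeval1 A) -mxevalB -uw addrK.
have ee : e *m e = e.
  apply/eqP; rewrite -subr_eq0 -opprB oppr_eq0 -[X in X - _]mulmx1 -mulmxBr e1.
  by rewrite -mxevalM mulrACA fgA.
have [r [K [Y [KY YK]]]] := idempotent_factor ee.
have [m [Z [W [ZW KW ZY eWZ]]]] := complement_mx KY.
have cA : Y *m K *m A = A *m (Y *m K).
  by rewrite YK -{1 2}(mxevalX A) mxevalMC.
have [PQ QP /(_ A cA) eA] := split_commuting KY ZW KW ZY eWZ.
have WZ : W *m Z = mxeval A (u * f) by rewrite -e1 -YK -eWZ addrAC subrr add0r.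
have cA' : W *m Z *m A = A *m (W *m Z) by rewrite WZ -{2 3}(mxevalX A) mxevalMC.
exists r, m, (K *m A *m Y), (Z *m A *m W).
have Uf : mxeval (K *m A *m Y) f = 0.
  rewrite -[LHS]mulmx1 -KY mulmxA.
  rewrite (mxeval_intertwine _ (compress_intertwine KY cA)).
  rewrite -[K]mul1mx -KY -(mulmxA K Y K) YK -(mulmxA K) -mxevalM -mulrA fgA.
  by rewrite mulmx0 mul0mx.
have A0g : mxeval (Z *m A *m W) g = 0.
  rewrite -[LHS]mulmx1 -ZW mulmxA.
  rewrite (mxeval_intertwine _ (compress_intertwine ZW cA')).
  rewrite -[Z]mul1mx -ZW -(mulmxA Z W Z) WZ -(mulmxA Z) -mxevalM -mulrA.
  by rewrite [f * g]mulrC fgA mulmx0 mul0mx.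
have [h hA0] := mxeval_coprime_unit cXg A0g.
exists (- mxeval (Z *m A *m W) h); split.
- by exists (row_mx Y W), (col_mx K Z).
- exists a; have -> : 'X^2 - 1 = ('X - 1%:P) * ('X + 1) :> {poly F}.
    by rewrite polyC1 -subr_sqr expr1n.
  by rewrite exprMn mxevalM Uf mul0mx.
rewrite mulmxN -mulNmx opprB; apply: mulmx1C.
by move: hA0; rewrite mxevalB mxevalX mxevalC.
Qed.

(** Multiplying by the swap s exchanges the two block rows. In
    T = | 0 I ; A X+Y | the corner X + Y is free, because A - I being
    invertible lets any corner of s T be cleared; and A = - X Y allows T to be
    conjugated to a triangular matrix, as T is the companion matrix of
    (t - X)(t - Y). *)
Lemma three_invols_of_factor n (A B X Y : 'M[F]_n) :
  (1%:M - A) *m B = 1%:M -> - A = X *m Y ->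
  two_invols (block_mx Y 1%:M 0 X) -> three_invols (dsum A (1%:M : 'M_n)).
Proof.
move=> AB eA tXY; pose s : 'M[F]_(n + n) := block_mx 0 1%:M 1%:M 0.
have ss : mxinvol s.
  rewrite /mxinvol mulmx_block !mulmx0 !mul0mx !mulmx1 !addr0 !add0r.
  by rewrite -scalar_mx_block.
pose T : 'M[F]_(n + n) := block_mx 0 1%:M A (X + Y).
have sT : s *m T = block_mx A (X + Y) 0 1%:M.
  by rewrite mulmx_block !mul0mx !mul1mx !addr0 !add0r.
apply: (three_invols_sim (B := s *m T)).
  rewrite sT; apply: msim_sym; apply: (msim_ublock (Z := B *m (X + Y))).
  rewrite mulmx1 mulmxA -{1}[B *m _]mul1mx mulmxA -mulmxBl -mulmxBl AB.
  by rewrite mul1mx.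
apply: mul_invol_two_invols ss _; apply: two_invols_sim tXY.
(* Conjugation by Y below the diagonal splits off the right factor t - Y. *)
exists (block_mx 1%:M 0 Y 1%:M), (block_mx 1%:M 0 (- Y) 1%:M).
rewrite !mulmx_block !mulmx0 !mul0mx !mulmx1 !mul1mx !addr0 !add0r.
rewrite addrN addNr -scalar_mx_block; split=> //.
congr block_mx.
- by rewrite mul1mx addrN.
- by rewrite mulmxN mulmxDl opprD addNKr -eA opprK.
- exact: addrC.
Qed.

(** The unipotent summand is treated apart because the freedom in the corner
    block comes from the invertibility of A0 - I. *)
Theorem stable_three_invols n (A : 'M[F]_n) : \det A ^+ 2 = 1 ->
  exists p, three_invols (dsum A (1%:M : 'M_p)).
Proof.
move=> dA; have [n1 [n2 [U [A0 [B0 [simA pU AB]]]]]] := fitting_at_one A.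
have tU := spectrum_pm1_two_invols pU.
have dA0 : \det A0 ^+ 2 = 1.
  have := msim_det simA; rewrite /dsum det_ublock => e; move: dA.
  by rewrite e exprMn (two_invols_det tU) mul1r.
have core : exists p, three_invols (dsum A0 (1%:M : 'M_p)).
  have [A0A0|nA0] := eqVneq (A0 *m A0) 1%:M.
    exists 0; exists (dsum A0 1%:M), 1%:M, 1%:M; rewrite !mulmx1.
    split=> //; try exact: mxinvol1.
    by apply: mxinvol_dsum => //; apply: mxinvol1.
  suff [X [Y [eXY tXY]]] : exists X Y,
      - A0 = X *m Y /\ two_invols (block_mx Y 1%:M 0 X).
    by exists n2; apply: three_invols_of_factor AB eXY tXY.
  have [/is_scalar_mxP[d ed]|ns] := boolP (is_scalar_mx A0).
    move: dA0 nA0; rewrite ed det_scalar -scalar_mxM.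
    case: (n2) => [|k] dA0 nA0; first by case/eqP: nA0; apply/matrixP => -[].
    apply: scalar_factor => //; apply: contraNneq nA0; rewrite -expr2 => ->.
    by [].
  have [||X [Y [pX pY eXY]]] := @nonscalar_factor _ _ (- A0).
  - by rewrite -scaleN1r detZ exprMn dA0 mulr1 -exprM mulnC exprM sqrrN !expr1n.
  - apply/orP; right; apply: contra ns => /is_scalar_mxP[c ec].
    by apply/is_scalar_mxP; exists (- c); rewrite raddfN /= -ec opprK.
  exists X, Y; split=> //.
  exact/spectrum_pm1_two_invols/spectrum_pm1_ublock.
have [p tp] := core; exists p.
apply: three_invols_sim (three_invols_dsum tU tp).
apply: msim_trans (msim_dsumA _ _ _).
exact: msim_dsum (msim_refl _).
Qed.

End ThreeInvolutions.

(** * Transfer to the stable group *)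
Section StableClasses.
Variable F : fieldType.
Implicit Types x g : GLinf F.

Lemma GLclass_mulmx n (A B : 'M[F]_n) (uA : A \in unitmx) (uB : B \in unitmx)
    (uAB : A *m B \in unitmx) :
  (GLclass uA * GLclass uB)%g = GLclass uAB.
Proof. by rewrite GLclassM; apply/GLclass_eq/stable_mul_same. Qed.

Lemma GLclass_one n (u1 : (1%:M : 'M[F]_n) \in unitmx) : GLclass u1 = 1%g.
Proof. exact/GLclass_eq/stably_equal_id. Qed.

Lemma GLclass_inv n (A : 'M[F]_n) (uA : A \in unitmx)
    (uV : invmx A \in unitmx) :
  GLclass uV = (GLclass uA)^-1%g.
Proof.
have uAV : A *m invmx A \in unitmx by rewrite unitmx_mul uA.
apply: (mulgI (GLclass uA)); rewrite mulgV (GLclass_mulmx _ _ uAV).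
rewrite -(GLclass_one (unitmx1 F n)).
by apply/GLclass_eq; rewrite mulmxV //; apply/stably_equalP.
Qed.

Lemma dsum1_unit n p (A : 'M[F]_n) :
  A \in unitmx -> dsum A (1%:M : 'M_p) \in unitmx.
Proof. by rewrite !unitmxE det_dsum. Qed.

Lemma GLclass_dsum1 n p (A : 'M[F]_n) (uA : A \in unitmx)
    (uA1 : dsum A (1%:M : 'M_p) \in unitmx) :
  GLclass uA1 = GLclass uA.
Proof. by apply/GLclass_eq/stably_equalP; apply: ext_dsum. Qed.

Lemma mxinvol_unit n (a : 'M[F]_n) : mxinvol a -> a \in unitmx.
Proof. by case/mulmx1_unit. Qed.

Lemma involution_GLclass n (a : 'M[F]_n) (ua : a \in unitmx) :
  mxinvol a -> involution (GLclass ua).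
Proof.
move=> aa; rewrite /involution expgS expg1.
have uaa : a *m a \in unitmx by rewrite aa unitmx1.
rewrite (GLclass_mulmx _ _ uaa) -(GLclass_one (unitmx1 F n)).
by apply/GLclass_eq; rewrite aa; apply/stably_equalP.
Qed.

(** Lets identities of the stable group be read as identities of matrices. *)
Lemma GLclass_common_size x g :
  exists n (A B : 'M[F]_n) (uA : A \in unitmx) (uB : B \in unitmx),
    x = GLclass uA /\ g = GLclass uB.
Proof.
have [n [A [uA ->]]] := GLclass_ex x; have [p [B [uB ->]]] := GLclass_ex g.
have uB' : castmx (addnC p n, addnC p n) (dsum B (1%:M : 'M_n)) \in unitmx.
  by rewrite unitmxE det_cast det_dsum -unitmxE.
exists (n + p)%N, (dsum A 1%:M), _, (dsum1_unit p uA), uB'; split.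
  by rewrite (GLclass_dsum1 uA).
by apply/GLclass_eq/stably_equalP => i j; rewrite ext_cast ext_dsum.
Qed.

Lemma GLclass_inj n (A B : 'M[F]_n) (uA : A \in unitmx) (uB : B \in unitmx) :
  GLclass uA = GLclass uB -> A = B.
Proof. by move/GLclass_eq/stably_equalP/ext_inj. Qed.

Lemma conj_inverse_two_involutions x g :
  (x ^ g)%g = (x^-1)%g ->
  exists a b, [/\ involution a, involution b & x = (a * b)%g].
Proof.
have [n [A [B [uA [uB [-> ->]]]]]] := GLclass_common_size x g.
move=> e.
have uAB : A *m B \in unitmx by rewrite unitmx_mul uA.
have uV : invmx A \in unitmx by rewrite unitmx_inv.
have uBV : B *m invmx A \in unitmx by rewrite unitmx_mul uB.
have eAB : A *m B = B *m invmx A.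
  apply: (GLclass_inj (uA := uAB) (uB := uBV)).
  rewrite -(GLclass_mulmx uA uB) -(GLclass_mulmx uB uV) (GLclass_inv uA) -e.
  by rewrite conjgE mulVKg.
have [a [b [aa bb eab]]] : two_invols A.
  apply: msim_inverse_two_invols (mulmxV uA) _.
  apply: msim_sym; apply: (msim_conj uB); by rewrite -eAB.
exists (GLclass (mxinvol_unit aa)), (GLclass (mxinvol_unit bb)).
split; try exact: involution_GLclass.
have uab : a *m b \in unitmx by rewrite -eab.
rewrite (GLclass_mulmx _ _ uab); apply/GLclass_eq; rewrite eab.
exact/stably_equalP.
Qed.

Lemma det_pm1_three_involutions x : GLdet x = 1 \/ GLdet x = -1 ->
  exists a b c, [/\ involution a, involution b, involution c
    & x = (a * b * c)%g].
Proof.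
have [n [A [uA ->]]] := GLclass_ex x; rewrite GLdet_class => dA.
have [|p [a [b [c [aa bb cc e]]]]] := @stable_three_invols _ _ A.
  by case: dA => ->; rewrite ?sqrrN expr1n.
exists (GLclass (mxinvol_unit aa)), (GLclass (mxinvol_unit bb)),
  (GLclass (mxinvol_unit cc)).
split; try exact: involution_GLclass.
have uab : a *m b \in unitmx by rewrite unitmx_mul !mxinvol_unit.
have uabc : a *m b *m c \in unitmx by rewrite unitmx_mul uab mxinvol_unit.
rewrite (GLclass_mulmx _ _ uab) (GLclass_mulmx _ _ uabc).
rewrite -(GLclass_dsum1 uA (dsum1_unit p uA)).
by apply/GLclass_eq; rewrite e; apply/stably_equalP.
Qed.

Lemma involution_det x : involution x -> GLdet x ^+ 2 = 1.
Proof. by rewrite expr2 -GLdetM => xx; rewrite -[RHS]GLdet1 -xx. Qed.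

Lemma two_involutions_conj (G : groupType) (a b : G) :
  involution a -> involution b -> ((a * b) ^ a = (a * b)^-1)%g.
Proof.
rewrite /involution !(expgS _ 1) !expg1 => aa bb.
apply: (mulgI (a * b)%g); rewrite mulgV conjgE.
have aV : (a^-1 = a)%g by apply: (mulgI a); rewrite mulgV aa.
by rewrite aV -!mulgA (mulgA a a) aa mul1g (mulgA b b) bb mul1g.
Qed.

Lemma det_prod_involutions (s : seq (GLinf F)) :
  (forall y, y \in s -> involution y) ->
  GLdet (\prod_(y <- s) y)%g = 1 \/ GLdet (\prod_(y <- s) y)%g = -1.
Proof.
move=> hs; suff : GLdet (\prod_(y <- s) y)%g ^+ 2 = 1.
  by move/eqP; rewrite sqrf_eq1 => /orP[]/eqP; [left|right].
elim: s hs => [|y s IH] hs; first by rewrite big_nil GLdet1 expr1n.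
rewrite big_cons GLdetM exprMn involution_det ?mul1r; last first.
  by apply: hs; apply: mem_head.
by apply: IH => z zs; apply: hs; rewrite inE zs orbT.
Qed.

End StableClasses.

Theorem theorem1p1 (F : fieldType) :
  [/\ forall x : GLinf F,
        (exists2 s : seq (GLinf F),
           forall y : GLinf F, y \in s -> involution y
           & x = (\prod_(y <- s) y)%g)
        <-> (GLdet x = 1%R \/ GLdet x = (-1)%R),
      forall x : GLinf F,
        (exists a b : GLinf F,
           [/\ involution a, involution b & x = (a * b)%g])
        <-> (exists g : GLinf F, (x ^ g)%g = (x^-1)%g)
    & forall x : GLinf F,
        GLdet x = 1%R \/ GLdet x = (-1)%R ->
        exists a b c : GLinf F,
          [/\ involution a, involution b, involution c
            & x = (a * b * c)%g] ].
Proof.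
split=> [x|x|x]; last exact: det_pm1_three_involutions.
  split=> [[s hs ->]|]; first exact: det_prod_involutions.
  case/det_pm1_three_involutions => a [b [c [ia ib ic ->]]].
  exists [:: a; b; c].
    by move=> y; rewrite !inE => /or3P[]/eqP->.
  by rewrite !big_cons big_nil mulg1 mulgA.
split=> [[a [b [ia ib ->]]]|[g]]; last exact: conj_inverse_two_involutions.
by exists a; apply: two_involutions_conj.
Qed.
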